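(* Let $d\ge 2$. If the graph of a stacked $(d+1)$-polytope is $d$-ball packable, then its $d$-ball packing is Apollonian, and it is unique up to Möbius transformations and reflections.
   Context: A simplicial polytope is stacked if it is obtained from a simplex by repeatedly gluing a new simplex onto a facet. A $d$-ball in $\hat{\mathbb R}^d$ is a closed ball, closed exterior of an open ball with $\infty$, or a closed half-space with $\infty$; a $d$-ball packing is a collection of $d$-balls with disjoint interiors; its tangency graph joins balls meeting in exactly one point; a graph is $d$-ball packable if isomorphic to the tangency graph of some $d$-ball packing. A Descartes configuration in dimension $d$ is a set of $d+2$ pairwise tangent $d$-balls with disjoint interiors. A collection of $d$-balls is Apollonian if it can be built from a Descartes configuration by repeatedly adding, for some $d+1$ pairwise tangent balls already present, a new ball tangent to all of them. *)

(* Defs.v *)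
From HB Require Import structures.
From mathcomp Require Import all_boot all_order all_algebra.
Set Implicit Arguments. Unset Strict Implicit. Unset Printing Implicit Defensive.
Import Order.TTheory GRing.Theory Num.Theory.
Local Open Scope ring_scope.

Section Vectors.
Variable R : rcfType.

Definition dotv (n : nat) (u v : 'rV[R]_n) : R := \sum_(i < n) u 0 i * v 0 i.
Definition nrm2 (n : nat) (u : 'rV[R]_n) : R := dotv u u.

(* Convex polytopes P = conv(s) in R^n, s a finite list of points.      *)

Definition affdim (n : nat) (s : seq 'rV[R]_n) : nat :=
  \rank (\matrix_(i < (size s).-1) (nth 0 s i.+1 - nth 0 s 0)).

Definition supports (n : nat) (s : seq 'rV[R]_n) (c : 'rV[R]_n) (a : R) : bool :=
  all (fun x => dotv c x <= a) s.

Definition face_on (n : nat) (s : seq 'rV[R]_n) (c : 'rV[R]_n) (a : R) :=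
  [seq x <- s | dotv c x == a].

Definition is_facet (n : nat) (s : seq 'rV[R]_n) (c : 'rV[R]_n) (a : R) : Prop :=
  c != 0 /\ supports s c a /\ affdim (face_on s c a) = n.-1.

(* stacked n-polytopes, given by their vertex lists: start from an
   n-simplex; glue a new simplex conv(F u {p}) onto a facet F, where p is
   beyond F and beneath every other facet (so the union is convex and
   equals conv(p :: s)). *)
Inductive stacked (n : nat) : seq 'rV[R]_n -> Prop :=
| stacked_simplex s :
    size s = n.+1 -> affdim s = n -> stacked s
| stacked_glue s c a p :
    stacked s -> is_facet s c a -> a < dotv c p ->
    (forall c' a', is_facet s c' a' ->
        face_on s c' a' =i face_on s c a \/ dotv c' p < a') ->
    stacked (p :: s).

Definition poly_edge (n : nat) (s : seq 'rV[R]_n) (x y : 'rV[R]_n) : Prop :=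
  [/\ x \in s, y \in s, x != y &
    exists c a, supports s c a /\
      (forall z, z \in s -> (dotv c z == a) = (z == x) || (z == y))].

Definition stacked_polytope_graph (n : nat) (V : finType) (e : rel V) : Prop :=
  exists (s : seq 'rV[R]_n) (f : V -> 'rV[R]_n),
    [/\ stacked s, injective f, (forall v, f v \in s),
        (forall x, x \in s -> exists v, f v = x) &
        (forall u v, e u v <-> poly_edge s (f u) (f v))].

End Vectors.

Section Balls.
Variables (R : rcfType) (d : nat).

(* points of the extended space R^d u {oo}; None is the point oo *)
Definition xpoint := option 'rV[R]_d.

(* d-balls of \hat R^d:
   BIn c r   = closed ball {x : |x-c| <= r}                  (r > 0)
   BOut c r  = {x : |x-c| >= r} u {oo}                      (r > 0)
   BHalf v a = {x : v.x <= a} u {oo}                        (v <> 0) *)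
Inductive ball :=
| BIn of 'rV[R]_d & R
| BOut of 'rV[R]_d & R
| BHalf of 'rV[R]_d & R.

Definition wf_ball (B : ball) : Prop :=
  match B with
  | BIn _ r => 0 < r
  | BOut _ r => 0 < r
  | BHalf v _ => v != 0
  end.

Definition in_ball (B : ball) (p : xpoint) : bool :=
  match B, p with
  | BIn c r, Some x => nrm2 (x - c) <= r ^+ 2
  | BIn _ _, None => false
  | BOut c r, Some x => r ^+ 2 <= nrm2 (x - c)
  | BOut _ _, None => true
  | BHalf v a, Some x => dotv v x <= a
  | BHalf _ _, None => true
  end.

Definition in_interior (B : ball) (p : xpoint) : bool :=
  match B, p with
  | BIn c r, Some x => nrm2 (x - c) < r ^+ 2
  | BIn _ _, None => false
  | BOut c r, Some x => r ^+ 2 < nrm2 (x - c)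
  | BOut _ _, None => true
  | BHalf v a, Some x => dotv v x < a
  | BHalf _ _, None => false
  end.

Definition disjoint_interiors (B1 B2 : ball) : Prop :=
  forall p, ~ (in_interior B1 p /\ in_interior B2 p).

Definition tangent (B1 B2 : ball) : Prop :=
  exists! p, in_ball B1 p /\ in_ball B2 p.

Definition packing (V : finType) (B : V -> ball) : Prop :=
  (forall v, wf_ball (B v)) /\
  (forall u v, u != v -> disjoint_interiors (B u) (B v)).

Definition realizes (V : finType) (e : rel V) (B : V -> ball) : Prop :=
  packing B /\ (forall u v, u != v -> (e u v <-> tangent (B u) (B v))).

Definition ball_packable (V : finType) (e : rel V) : Prop :=
  exists B : V -> ball, realizes e B.

Definition apollonian (V : finType) (B : V -> ball) : Prop :=
  exists s : seq V,
    [/\ uniq s /\ (forall v, v \in s), (d.+2 <= size s)%N,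
        (forall v, v \in take d.+2 s -> wf_ball (B v)),
        (forall u v, u \in take d.+2 s -> v \in take d.+2 s -> u != v ->
            tangent (B u) (B v) /\ disjoint_interiors (B u) (B v)) &
        (forall s1 w s2, s = s1 ++ w :: s2 -> (d.+2 <= size s1)%N ->
            exists t : seq V,
              size t = d.+1 /\ uniq t /\ {subset t <= s1} /\
              (forall u v, u \in t -> v \in t -> u != v ->
                 tangent (B u) (B v)) /\
              (forall u, u \in t -> tangent (B w) (B u)))].

Definition inversion (c : 'rV[R]_d) (r : R) (p : xpoint) : xpoint :=
  match p with
  | None => Some c
  | Some x => if x == c then None
              else Some (c + (r ^+ 2 / nrm2 (x - c)) *: (x - c))
  end.

Definition reflection (v : 'rV[R]_d) (a : R) (p : xpoint) : xpoint :=
  match p with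
  | None => None
  | Some x => Some (x - ((2 * (dotv v x - a)) / nrm2 v) *: v)
  end.

Inductive mobius : (xpoint -> xpoint) -> Prop :=
| mobius_id : mobius id
| mobius_inv c r f : 0 < r -> mobius f -> mobius (inversion c r \o f)
| mobius_refl v a f : v != 0 -> mobius f -> mobius (reflection v a \o f).

Definition maps_ball (f : xpoint -> xpoint) (B B' : ball) : Prop :=
  forall q, in_ball B' q <-> exists p, in_ball B p /\ f p = q.

Definition mobius_equiv (V W : finType) (B1 : V -> ball) (B2 : W -> ball) : Prop :=
  exists f, mobius f /\
    (forall u, exists w, maps_ball f (B1 u) (B2 w)) /\
    (forall w, exists u, maps_ball f (B1 u) (B2 w)).

End Balls.

(* Main.v *)
(** Combinatorics.  After homogenizing x to (1, x), gluing a simplex onto the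
    facet F of a stacked polytope S with a new apex p is controlled by the
    functionals dual to the simplex p :: F: they are nonnegative on S because
    the segment from p to a vertex of S enters the polytope through F, and
    positive off F because otherwise they would define another facet of S
    through p.  Hence p is joined to a clique F of size d+1, which
    already lies in a clique of size d+2, and no old edge disappears.

    Geometry.  Balls are unit vectors b of a Lorentz space of dimension d+2
    and points are null vectors; disjoint tangent balls satisfy <b, b'> = -1,
    and b + b' is a positive multiple of the tangency point.  Two Descartes
    configurations are matched ball by ball: the difference of the next two
    unit vectors is orthogonal to a tangency point already matched, hence it
    is zero or space-like, and the reflection in it is an inversion or a
    Euclidean reflection.  A ball tangent to t_1, ..., t_{d+1}, themselves
    tangent to u, is either u or 2/(d-1) (t_1 + ... + t_{d+1}) - u, so every
    further ball of the packing is determined linearly by the earlier ones. *)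
Require Import Defs.
From HB Require Import structures.
From mathcomp Require Import all_boot all_order all_algebra.
From mathcomp Require Import ring lra.
Set Implicit Arguments. Unset Strict Implicit. Unset Printing Implicit Defensive.
Import Order.TTheory GRing.Theory Num.Theory.
Local Open Scope ring_scope.

(** * Bilinearity and positivity of the dot product *)

Section DotProduct.
Variables (R : rcfType) (n : nat).
Implicit Types (u v w : 'rV[R]_n) (a : R).

Lemma dotv_mx u v : dotv u v = (u *m v^T) 0 0.
Proof. by rewrite mxE; apply: eq_bigr => i _; rewrite mxE. Qed.

Lemma dotvC u v : dotv u v = dotv v u.
Proof. by apply: eq_bigr => i _; rewrite mulrC. Qed.

Lemma dotvDl u v w : dotv (u + v) w = dotv u w + dotv v w.
Proof. by rewrite !dotv_mx mulmxDl mxE. Qed.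

Lemma dotvZl a u v : dotv (a *: u) v = a * dotv u v.
Proof. by rewrite !dotv_mx -scalemxAl mxE. Qed.

Lemma dotvDr u v w : dotv u (v + w) = dotv u v + dotv u w.
Proof. by rewrite dotvC dotvDl !(dotvC u). Qed.

Lemma dotvZr a u v : dotv u (a *: v) = a * dotv u v.
Proof. by rewrite dotvC dotvZl dotvC. Qed.

Lemma dotvNl u v : dotv (- u) v = - dotv u v.
Proof. by rewrite -scaleN1r dotvZl mulN1r. Qed.

Lemma dotvNr u v : dotv u (- v) = - dotv u v.
Proof. by rewrite dotvC dotvNl dotvC. Qed.

Lemma dotv0l v : dotv 0 v = 0.
Proof. by rewrite -(scale0r 0) dotvZl mul0r. Qed.

Lemma dotv0r v : dotv v 0 = 0.
Proof. by rewrite dotvC dotv0l. Qed.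

Lemma dotv_suml (I : Type) (r : seq I) (P : pred I) (F : I -> 'rV[R]_n) v :
  dotv (\sum_(i <- r | P i) F i) v = \sum_(i <- r | P i) dotv (F i) v.
Proof.
by apply: (big_morph (fun u => dotv u v)); [move=> *; apply: dotvDl | apply: dotv0l].
Qed.

Lemma dotv_sumr (I : Type) (r : seq I) (P : pred I) (F : I -> 'rV[R]_n) v :
  dotv v (\sum_(i <- r | P i) F i) = \sum_(i <- r | P i) dotv v (F i).
Proof. by rewrite dotvC dotv_suml; apply: eq_bigr => i _; rewrite dotvC. Qed.

Lemma nrm2_ge0 u : 0 <= nrm2 u.
Proof. by apply: sumr_ge0 => i _; rewrite -expr2 sqr_ge0. Qed.

Lemma nrm2_eq0 u : (nrm2 u == 0) = (u == 0).
Proof.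
apply/idP/eqP => [|->]; last by rewrite /nrm2 dotv0l.
rewrite psumr_eq0; last by move=> i _; rewrite -expr2 sqr_ge0.
move/allP => H; apply/rowP => i; rewrite mxE.
by have /implyP/(_ isT) := H i (mem_index_enum _); rewrite -expr2 sqrf_eq0 => /eqP.
Qed.

Lemma nrm2_gt0 u : (0 < nrm2 u) = (u != 0).
Proof. by rewrite lt_def nrm2_ge0 andbT nrm2_eq0. Qed.

End DotProduct.

Lemma dotv_row_mx (R : rcfType) (n1 n2 : nat) (u1 v1 : 'rV[R]_n1) (u2 v2 : 'rV[R]_n2) :
  dotv (row_mx u1 u2) (row_mx v1 v2) = dotv u1 v1 + dotv u2 v2.
Proof. by rewrite !dotv_mx tr_row_mx mul_row_col mxE. Qed.

(** * Ranks of lists of vectors and dual bases *)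

Section ListRank.
Variables (R : rcfType) (k : nat).
Local Notation W := 'rV[R]_k.+1.
Implicit Types (s t : seq W) (h x y z : W).

Definition rows_mx s : 'M[R]_(size s, k.+1) := \matrix_(i < size s) nth 0 s i.
Definition rk s : nat := \rank (rows_mx s).

Lemma mem_rows_mx x s : x \in s -> (x <= rows_mx s)%MS.
Proof.
move=> xs; have i_lt : (index x s < size s)%N by rewrite index_mem.
have -> : x = row (Ordinal i_lt) (rows_mx s) by rewrite rowK /= nth_index.
exact: row_sub.
Qed.

Lemma rows_mx_sub (q : nat) s (A : 'M_(q, k.+1)) :
  (forall x, x \in s -> (x <= A)%MS) -> (rows_mx s <= A)%MS.
Proof. by move=> H; apply/row_subP => i; rewrite rowK; apply/H/mem_nth. Qed.

Lemma rk_sub s t : {subset s <= t} -> (rk s <= rk t)%N.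
Proof. by move=> H; apply/mxrankS/rows_mx_sub => x /H; apply: mem_rows_mx. Qed.

Lemma rk_size s : (rk s <= size s)%N.
Proof. exact: rank_leq_row. Qed.

Lemma rk_width s : (rk s <= k.+1)%N.
Proof. exact: rank_leq_col. Qed.

Lemma rk_cons_le x s : (rk (x :: s) <= (rk s).+1)%N.
Proof.
have le_xs : (rows_mx (x :: s) <= x + rows_mx s)%MS.
  apply: rows_mx_sub => y; rewrite inE => /predU1P[->|ys]; first exact: addsmxSl.
  by apply: submx_trans (addsmxSr _ _); apply: mem_rows_mx.
apply: leq_trans (mxrankS le_xs) _.
by apply: leq_trans (mxrank_adds_leqif _ _) _; rewrite -[(rk s).+1]add1n leq_add2r rank_leq_row.
Qed.

Lemma rows_mx_annihil s h :
  (forall y, y \in s -> dotv h y = 0) -> rows_mx s *m h^T = 0.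
Proof.
move=> hs; apply/row_matrixP => i; rewrite row_mul rowK row0.
by apply/matrixP => a b; rewrite !ord1 -dotv_mx dotvC hs ?mxE ?mem_nth.
Qed.

Lemma rk_cons_gt x s h :
  (forall y, y \in s -> dotv h y = 0) -> dotv h x != 0 -> rk (x :: s) = (rk s).+1.
Proof.
move=> hs hx; apply/eqP; rewrite eqn_leq rk_cons_le /=; apply: rank_ltmx.
rewrite /ltmx; apply/andP; split.
  by apply: rows_mx_sub => y ys; apply: mem_rows_mx; rewrite inE ys orbT.
apply/negP => H; have xs : (x <= rows_mx s)%MS.
  by apply: submx_trans H; apply: mem_rows_mx; rewrite mem_head.
have /submxP[D xD] := xs; case/eqP: hx.
by rewrite dotvC dotv_mx xD -mulmxA rows_mx_annihil // mulmx0 mxE.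
Qed.

Lemma rk_annihil s h :
  h != 0 -> (forall y, y \in s -> dotv h y = 0) -> (rk s <= k)%N.
Proof.
move=> h0 hs; rewrite -ltnS ltn_neqAle rk_width andbT.
apply: contraNN h0 => full; have /row_fullP[B BA] : row_full (rows_mx s) by [].
have : B *m (rows_mx s *m h^T) = 0 by rewrite rows_mx_annihil // mulmx0.
by rewrite mulmxA BA mul1mx => /(congr1 trmx); rewrite trmxK trmx0 => ->.
Qed.

Lemma rk_full_annihil s h :
  rk s = k.+1 -> (forall y, y \in s -> dotv h y = 0) -> h = 0.
Proof.
move=> full hs; apply/eqP; apply: contraT => /rk_annihil/(_ hs).
by rewrite full ltnn.
Qed.

Lemma rk_size_uniq s : rk s = size s -> uniq s.
Proof.
move=> rs; rewrite -[uniq s]negbK -ltn_size_undup -leqNgt -rs.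
by apply: leq_trans (rk_sub (t := undup s) _) (rk_size _) => x; rewrite mem_undup.
Qed.

(** The functionals are indexed by the vectors themselves rather than by positions, so that faces
    can be handled as sublists without renumbering. *)
Definition dual_on s (b : W -> W) : Prop :=
  (forall x y, x \in s -> y \in s -> dotv (b x) y = (x == y)%:R) /\
  (forall z, z = \sum_(x <- s) dotv (b x) z *: x).

(** The functionals are the columns of the inverse of the square matrix with rows [s]. *)
Lemma simplex_dual s : size s = k.+1 -> rk s = k.+1 -> exists b, dual_on s b.
Proof.
move=> ss rs; have us : uniq s by apply: rk_size_uniq; rewrite rs.
set A := rows_mx s; set P := pinvmx A.
have AP : A *m P = 1%:M by apply: mulmxVp; rewrite /row_free -/(rk s) rs ss.
have PA : P *m A = 1%:M by apply: mulVpmx; rewrite /row_full -/(rk s) rs.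
(* As [s] has no repetition, at most one index contributes to the sum. *)
pose b x : W := \row_j \sum_(i < size s | nth 0 s i == x) P j i.
have bE x z : dotv (b x) z = \sum_(i < size s | nth 0 s i == x) (z *m P) 0 i.
  under [RHS]eq_bigr do rewrite mxE.
  rewrite exchange_big /=; apply: eq_bigr => j _; rewrite mxE mulr_suml.
  by apply: eq_bigr => i _; rewrite mulrC.
exists b; split=> [x y xs ys | z].
  have jP : (index y s < size s)%N by rewrite index_mem.
  have yP i : (y *m P) 0 i = (Ordinal jP == i)%:R.
    have yE : y = row (Ordinal jP) A by rewrite rowK /= nth_index.
    by rewrite {1}yE -row_mul AP !mxE.
  rewrite bE; under eq_bigr do rewrite yP.
  case: eqVneq => [->|xy].
    rewrite (bigD1 (Ordinal jP)) /= ?nth_index // eqxx big1 ?addr0 // => i /andP[_].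
    by rewrite eq_sym => /negPf ->.
  rewrite big1 // => i /eqP ix; case: eqVneq => // ji.
  by move: ix; rewrite -ji /= nth_index // => yx; rewrite yx eqxx in xy.
rewrite -{1}[z]mulmx1 -PA mulmxA mulmx_sum_row (big_nth 0) big_mkord.
apply: eq_bigr => j _; rewrite rowK bE.
congr (_ *: _); rewrite (big_pred1 j) // => i /=.
by rewrite nth_uniq.
Qed.

Lemma dual_eval s b h z :
  dual_on s b -> dotv h z = \sum_(x <- s) dotv (b x) z * dotv h x.
Proof.
case=> _ /(_ z) {1}->; rewrite dotv_sumr.
by apply: eq_bigr => x _; rewrite dotvZr.
Qed.

End ListRank.

(** * Stacked cones *)

(* [s] lists the vertices newest first; every new vertex [p] sees a [k]-clique
   [t] that an older vertex [u] completes to a [k+1]-clique. *)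
Inductive built (T : eqType) (k : nat) (E : T -> T -> Prop) : seq T -> Prop :=
| built_base s :
    size s = k.+1 -> uniq s ->
    (forall x y, x \in s -> y \in s -> x != y -> E x y) -> built k E s
| built_step s t u p :
    built k E s -> p \notin s -> size t = k -> uniq t -> {subset t <= s} ->
    u \in s -> u \notin t ->
    (forall x y, x \in t -> y \in t -> x != y -> E x y) ->
    (forall x, x \in t -> E u x) -> (forall x, x \in t -> E p x) ->
    built k E (p :: s).

Lemma built_mono (T : eqType) (k : nat) (E E' : T -> T -> Prop) s :
  (forall x y, E x y -> E' x y) -> built k E s -> built k E' s.
Proof.
move=> EE'; elim=> [{}s ss us Es | {}s t u p _ IH ps st ut ts us unt Et Eu Ep].
  by apply: built_base => // x y xs ys xy; apply/EE'/Es.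
by apply: (built_step (t := t) (u := u)) => // [x y xt yt xy | x xt | x xt];
  apply: EE'; [apply: Et | apply: Eu | apply: Ep].
Qed.

(** Finitely many strict inequalities survive a small perturbation; this gives the slack for tilting
    supporting functionals. *)
Lemma uniform_eps (R : rcfType) (T : eqType) (l : seq T) (A B : T -> R) :
  (forall z, z \in l -> 0 < A z) ->
  exists2 eps : R, 0 < eps & forall z, z \in l -> 0 < A z + eps * B z.
Proof.
elim: l => [|a l IH] Al; first by exists 1.
have [z zl|e e0 He] := IH; first by apply: Al; rewrite inE zl orbT.
have Aa : 0 < A a by apply: Al; rewrite mem_head.
have AB : 0 < `|B a| + 1 by rewrite ltr_wpDl.
exists (Num.min e (A a / (`|B a| + 1))); first by rewrite lt_min e0 divr_gt0.
set m := Num.min _ _; have m0 : 0 < m by rewrite lt_min e0 divr_gt0.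
have me : m <= e by rewrite ge_min lexx.
move=> z; rewrite inE => /predU1P[->|zl].
  have mA : m * (`|B a| + 1) <= A a by rewrite -ler_pdivlMr // ge_min lexx orbT.
  have : - `|B a| <= B a by rewrite lerNl -normrN ler_norm.
  by move=> Ba; nra.
have Az : 0 < A z by apply: Al; rewrite inE zl orbT.
by have := He z zl; have [Bz|Bz] := leP 0 (B z); nra.
Qed.

Section Cones.
Variables (R : rcfType) (k : nat).
Local Notation W := 'rV[R]_k.+1.
Implicit Types (S : seq W) (h p x y z : W).

Definition face S h := [seq x <- S | dotv h x == 0].
Definition nonneg S h := forall x, x \in S -> 0 <= dotv h x.
Definition facet S h := [/\ h != 0, nonneg S h & rk (face S h) = k].
Definition in_cone S y :=
  exists2 w : W -> R, (forall x, x \in S -> 0 <= w x) & y = \sum_(x <- S) w x *: x.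
Definition edge S x y :=
  [/\ x \in S, y \in S, x != y &
    exists2 h, nonneg S h & forall z, z \in S -> (dotv h z == 0) = (z == x) || (z == y)].

Inductive stacked_cone : seq W -> Prop :=
| stacked_cone_simplex S : size S = k.+1 -> rk S = k.+1 -> stacked_cone S
| stacked_cone_glue S h p :
    stacked_cone S -> facet S h -> dotv h p < 0 ->
    (forall h', facet S h' -> face S h' =i face S h \/ 0 < dotv h' p) ->
    stacked_cone (p :: S).

(** The half of the Minkowski-Weyl theorem that gluing needs, carried as an invariant of the
    construction instead of being proved for arbitrary cones. *)
Definition facets_cut_out S :=
  forall y, (forall h, facet S h -> 0 <= dotv h y) -> in_cone S y.

(** Together with the facet, [u] forms the larger clique that [built_step] asks for. *)
Definition simplicial_facets S :=
  forall h, facet S h ->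
    [/\ size (face S h) = k,
        forall x y, x \in face S h -> y \in face S h -> x != y -> edge S x y &
        exists u, [/\ u \in S, u \notin face S h &
                      forall x, x \in face S h -> edge S u x]].

Definition stacked_inv S :=
  [/\ uniq S, facets_cut_out S, simplicial_facets S & built k (edge S) S].

Lemma mem_face S h x : (x \in face S h) = (dotv h x == 0) && (x \in S).
Proof. by rewrite mem_filter. Qed.

Lemma face_sub S h : {subset face S h <= S}.
Proof. by move=> x; rewrite mem_face => /andP[]. Qed.

Lemma face_eq0 S h x : x \in face S h -> dotv h x = 0.
Proof. by rewrite mem_face => /andP[/eqP]. Qed.

Lemma rk_face_le S h : h != 0 -> (rk (face S h) <= k)%N.
Proof. by move=> h0; apply: rk_annihil h0 _ => x /face_eq0. Qed.

(** Everything comes from the dual basis: [b x] is the normal of the facet opposite [x], and the sum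
    of the [b g] with [g] different from [x] and [y] exposes the edge between them. *)
Lemma simplex_inv S : size S = k.+1 -> rk S = k.+1 -> stacked_inv S.
Proof.
move=> szS rkS; have uS : uniq S by apply: rk_size_uniq; rewrite rkS.
have [b dS] := simplex_dual szS rkS; have [bS bz] := dS.
have b_neq0 x : x \in S -> b x != 0.
  move=> xS; apply/eqP => bx0; have := bS x x xS xS.
  by rewrite bx0 dotv0l eqxx => /eqP; rewrite eq_sym oner_eq0.
have edgeS x y : x \in S -> y \in S -> x != y -> edge S x y.
  move=> xS yS xy; split=> //.
  have H z : z \in S -> dotv (\sum_(g <- S | (g != x) && (g != y)) b g) z =
                        ((z != x) && (z != y))%:R.
    move=> zS; rewrite dotv_suml big_mkcond (bigD1_seq z) //=.
    rewrite big_seq_cond big1 ?addr0 => [|g /andP[gS gz]].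
      by case: ifP => _ //; rewrite bS // eqxx.
    by rewrite bS // (negPf gz) if_same.
  exists (\sum_(g <- S | (g != x) && (g != y)) b g).
    by move=> z zS; rewrite H // ler0n.
  by move=> z zS; rewrite H // pnatr_eq0 eqb0 negb_and !negbK.
split=> //; last exact: built_base.
- move=> y Hy; exists (fun x => dotv (b x) y); last exact: bz.
  move=> x xS; apply: Hy; split; first exact: b_neq0.
    by move=> z zS; rewrite bS // ler0n.
  apply/eqP; rewrite eqn_leq rk_face_le ?b_neq0 //=.
  rewrite -ltnS -rkS; apply: leq_trans (rk_cons_le x _).
  apply: rk_sub => z zS; rewrite inE mem_face zS andbT bS // eq_sym.
  by case: eqVneq => //= _; rewrite eqxx.
move=> h [h0 hS rkh].
have [u uS' hu] : exists2 u, u \in S & dotv h u != 0.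
  apply/hasP; apply: contraT; rewrite -all_predC => /allP hall.
  case/eqP: h0; apply: (rk_full_annihil rkS) => y /hall /=.
  by rewrite negbK => /eqP.
have uf : u \notin face S h by rewrite mem_face (negPf hu).
split.
- apply/eqP; rewrite eqn_leq; apply/andP; split; last by rewrite -{1}rkh rk_size.
  suff : (size (u :: face S h) <= size S)%N by rewrite szS.
  apply: uniq_leq_size; first by rewrite /= uf filter_uniq.
  by move=> z; rewrite inE => /predU1P[->//|/face_sub].
- by move=> x y /face_sub xS /face_sub yS; apply: edgeS.
- exists u; split=> // x xf; apply: edgeS => //; first exact: face_sub xf.
  by apply: contraNneq uf => ->.
Qed.

(** * Gluing a simplicial cone onto a facet *)

Section Glue.
Variables (S : seq W) (h p : W) (b : W -> W).
Hypothesis k3 : (3 <= k)%N.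
Hypothesis uS : uniq S.
Hypothesis cutS : facets_cut_out S.
Hypothesis facet_h : facet S h.
Hypothesis size_face : size (face S h) = k.
Hypothesis hp : dotv h p < 0.
Hypothesis beneath :
  forall h', facet S h' -> face S h' =i face S h \/ 0 < dotv h' p.
Local Notation F := (face S h).
Hypothesis dual_b : dual_on (p :: F) b.

Let nonneg_h : nonneg S h. Proof. by case: facet_h. Qed.

Lemma glue_notin : p \notin S.
Proof. by apply/negP => /nonneg_h; rewrite leNgt hp. Qed.

Let pF : p \notin F.
Proof. by apply: contra glue_notin; apply: face_sub. Qed.

Let uF : uniq F. Proof. exact: filter_uniq. Qed.

Let bF f g : f \in F -> g \in F -> dotv (b f) g = (f == g)%:R.
Proof. by case: dual_b => bT _ fF gF; apply: bT; rewrite inE ?fF ?gF orbT. Qed.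

Let bfp f : f \in F -> dotv (b f) p = 0.
Proof.
case: dual_b => bT _ fF; rewrite bT ?mem_head ?inE ?fF ?orbT //.
by case: eqVneq fF pF => // -> ->.
Qed.

Let bpf f : f \in F -> dotv (b p) f = 0.
Proof.
case: dual_b => bT _ fF; rewrite bT ?mem_head ?inE ?fF ?orbT //.
by case: eqVneq fF pF => // -> ->.
Qed.

Let bpp : dotv (b p) p = 1.
Proof. by case: dual_b => bT _; rewrite bT ?mem_head ?eqxx. Qed.

Let evalE h' z :
  dotv h' z = dotv (b p) z * dotv h' p + \sum_(f <- F) dotv (b f) z * dotv h' f.
Proof. by rewrite (dual_eval h' z dual_b) big_cons. Qed.

Let eval_vanish h' z :
  (forall f, f \in F -> dotv h' f = 0) -> dotv h' z = dotv (b p) z * dotv h' p.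
Proof.
move=> h'F; rewrite evalE big_seq big1 ?addr0 // => f fF.
by rewrite h'F // mulr0.
Qed.

(** Both [h] and [b p] vanish on [F], so they are proportional, with negative factor [dotv h p]. *)
Let bpE z : dotv h z = dotv (b p) z * dotv h p.
Proof. by apply: eval_vanish => f /face_eq0. Qed.

Let h_gt0 x : x \in S -> x \notin F -> 0 < dotv h x.
Proof.
move=> xS xF; rewrite lt_def nonneg_h // andbT.
by apply: contra xF => hx; rewrite mem_face hx.
Qed.

Let bp_lt0 x : x \in S -> x \notin F -> dotv (b p) x < 0.
Proof. by move=> xS xF; have := h_gt0 xS xF; rewrite bpE nmulr_lgt0. Qed.

(** The crossing point [y] lies in the cone and is a nonnegative combination of vertices of [F]
    alone. As [b f] vanishes at [p], its sign at [x] is its sign at [y]. *)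
Lemma glue_dual_ge0 f x : f \in F -> x \in S -> 0 <= dotv (b f) x.
Proof.
move=> fF xS; have [xF|xF] := boolP (x \in F); first by rewrite bF // ler0n.
have hx := h_gt0 xS xF.
(* where the segment from p to x crosses the hyperplane of F, up to scaling *)
pose y := (- dotv h p) *: x + dotv h x *: p.
have hy : dotv h y = 0 by rewrite dotvDr !dotvZr; ring.
(* [y] satisfies every facet inequality: a functional with face [F] vanishes there, and any other is
   nonnegative at both [x] and [p]. *)
have [h' fh'|w w0 yE] := cutS (y := y).
  case: (beneath fh') => [ff | h'p].
    rewrite (@eval_vanish h'); last by move=> g; rewrite -ff => /face_eq0.
    have /eqP := bpE y; rewrite hy eq_sym mulf_eq0 (lt_eqF hp) orbF => /eqP ->.
    by rewrite mul0r.
  case: fh' => _ /(_ x xS) h'x _.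
  by rewrite dotvDr !dotvZr addr_ge0 ?mulr_ge0 ?oppr_ge0 ?(ltW hp) ?(ltW hx) ?(ltW h'p).
(* Complementary slackness: since [h] vanishes at [y], only vertices in [F] carry weight. *)
have wh z : z \in S -> w z * dotv h z = 0.
  have : \sum_(z <- S) w z * dotv h z = 0.
    by rewrite -[RHS]hy yE dotv_sumr; apply: eq_bigr => i _; rewrite dotvZr.
  rewrite big_seq => /eqP; rewrite psumr_eq0.
    by move=> /allP H zS; have /implyP/(_ zS)/eqP := H z zS.
  by move=> i iS; rewrite mulr_ge0 ?w0 ?nonneg_h.
have : 0 <= dotv (b f) y.
  rewrite yE dotv_sumr big_seq; apply: sumr_ge0 => z zS; rewrite dotvZr.
  have [zF|zF] := boolP (z \in F); first by rewrite bF // mulr_ge0 ?w0 ?ler0n.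
  have /eqP := wh z zS; rewrite mulf_eq0 (gt_eqF (h_gt0 zS zF)) orbF => /eqP ->.
  by rewrite mul0r.
by rewrite dotvDr !dotvZr bfp // mulr0 addr0 pmulr_rge0 // oppr_gt0.
Qed.

Let b_neq0 f : f \in F -> b f != 0.
Proof.
move=> fF; apply/eqP => bf0; have := bF fF fF.
by rewrite bf0 dotv0l eqxx => /eqP; rewrite eq_sym oner_eq0.
Qed.

(** Dropping [f] costs at most one dimension, and [x], off the hyperplane of [F], restores it. *)
Lemma glue_rk_rem f x : f \in F -> dotv h x != 0 -> (k <= rk (x :: rem f F))%N.
Proof.
move=> fF hx; rewrite (rk_cons_gt (h := h)) //; last first.
  by move=> y /mem_rem/face_eq0.
case: facet_h => _ _ rkF; rewrite -{1}rkF; apply: leq_trans (rk_cons_le f _).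
by apply: rk_sub => z zF; rewrite inE (mem_rem_uniq _ uF) inE zF andbT orbN.
Qed.

(** If [b f] vanished at [x], it would define a facet of [S] other than [F], and [p] would be
    strictly beneath it; but [b f] vanishes at [p]. *)
Lemma glue_dual_gt0 f x : f \in F -> x \in S -> x \notin F -> 0 < dotv (b f) x.
Proof.
move=> fF xS xF; rewrite lt_def glue_dual_ge0 // andbT; apply/negP => bfx.
have fb : facet S (b f).
  split; [exact: b_neq0 | by move=> z; apply: glue_dual_ge0 |].
  apply/eqP; rewrite eqn_leq rk_face_le ?b_neq0 //=.
  apply: leq_trans (glue_rk_rem fF (x := x) _) _; first by rewrite gt_eqF ?h_gt0.
  apply: rk_sub => z; rewrite inE => /predU1P[->|]; first by rewrite mem_face bfx.
  rewrite (mem_rem_uniq _ uF) inE => /andP[zf zF].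
  by rewrite mem_face bF // [f == z]eq_sym (negPf zf) eqxx; apply: face_sub zF.
case: (beneath fb) => [/(_ f) | ]; last by rewrite bfp // ltxx.
by rewrite fF mem_face bF // eqxx oner_eq0.
Qed.

Lemma glue_facet_old h' :
  facet (p :: S) h' -> 0 < dotv h' p -> face (p :: S) h' = face S h' /\ facet S h'.
Proof.
move=> [h'0 h'S rk'] h'p.
have E : face (p :: S) h' = face S h' by rewrite /face /= gt_eqF.
split=> //; split=> //; last by rewrite -E.
by move=> z zS; apply: h'S; rewrite inE zS orbT.
Qed.

Lemma glue_full : rk (p :: F) = k.+1.
Proof.
case: facet_h => _ _ rkF; rewrite (rk_cons_gt (h := h)) ?rkF ?lt_eqF //.
by move=> y /face_eq0.
Qed.

(** In the coordinates of [p :: F], the value of [h'] at an old vertex off [F] is a sum of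
    nonnegative terms, and the term of a vertex [f] where [h'] is nonzero is positive. So the face
    lies in [p :: rem f F], and its rank [k] forces equality. *)
Lemma glue_facet_new h' :
  facet (p :: S) h' -> dotv h' p = 0 ->
  exists2 f, f \in F & face (p :: S) h' =i p :: rem f F.
Proof.
move=> [h'0 h'S rk'] h'p.
have [f fF h'f] : exists2 f, f \in F & dotv h' f != 0.
  apply/hasP; apply: contraT; rewrite -all_predC => /allP hall.
  case/eqP: h'0; apply: (rk_full_annihil glue_full) => y.
  rewrite inE => /predU1P[->//|/hall /=].
  by rewrite negbK => /eqP.
have h'ge z : z \in S -> 0 <= dotv h' z by move=> zS; apply: h'S; rewrite inE zS orbT.
exists f => //.
have sub : {subset face (p :: S) h' <= p :: rem f F}.
  move=> z; rewrite mem_face inE => /andP[/eqP h'z /predU1P[->|zS]].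
    by rewrite mem_head.
  have zf : z != f by apply: contraNneq h'f => <-; apply/eqP.
  rewrite inE (mem_rem_uniq _ uF) inE zf /=; apply/orP; right.
  apply: contraT => zF; have := evalE h' z.
  rewrite h'z h'p mulr0 add0r (bigD1_seq f) //= => /eqP.
  rewrite lt_eqF // ltr_wpDr //.
    rewrite big_seq_cond; apply: sumr_ge0 => g /andP[gF _].
    by rewrite mulr_ge0 ?glue_dual_ge0 ?h'ge //; apply: face_sub gF.
  by rewrite mulr_gt0 ?glue_dual_gt0 // lt_def h'f h'ge //; apply: face_sub fF.
have uf : uniq (face (p :: S) h') by rewrite filter_uniq //= glue_notin.
have := uniq_min_size uf sub; case=> //.
rewrite /= size_rem // size_face prednK; last by rewrite (leq_trans _ k3).
by rewrite -{1}rk' rk_size.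
Qed.

Lemma glue_facet_dual f : f \in F -> facet (p :: S) (b f).
Proof.
move=> fF; split; first exact: b_neq0.
  by move=> z; rewrite inE => /predU1P[->|]; [rewrite bfp | apply: glue_dual_ge0].
apply/eqP; rewrite eqn_leq rk_face_le ?b_neq0 // andTb.
apply: leq_trans (glue_rk_rem fF (x := p) _) _; first by rewrite lt_eqF.
apply: rk_sub => z; rewrite inE => /predU1P[->|].
  by rewrite mem_face bfp // eqxx mem_head.
rewrite (mem_rem_uniq _ uF) inE => /andP[zf zF].
by rewrite mem_face bF // [f == z]eq_sym (negPf zf) eqxx inE (face_sub zF) orbT.
Qed.

(** Here [3 <= k] matters: an edge functional needs a vertex of [F] away from both ends. *)
Let third x y : exists2 f, f \in F & (f != x) && (f != y).
Proof.
apply/hasP; apply: contraT; rewrite -all_predC => /allP H.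
have : (size F <= size [:: x; y])%N.
  apply: uniq_leq_size => // z /H /=.
  by rewrite negb_and !negbK !inE.
by rewrite size_face leqNgt k3.
Qed.

(** The sum [Q] of the [b g] over vertices of [F] off the edge has the right signs except that it
    vanishes at [p]. If [p] is not an end, a small multiple of [b p] is added: it is positive at
    [p], zero on [F], and by [uniform_eps] harmless at the other vertices. *)
Lemma glue_edge_new x y :
  x \in p :: F -> y \in p :: F -> x != y -> edge (p :: S) x y.
Proof.
have sub : {subset p :: F <= p :: S}.
  by move=> z; rewrite !inE => /predU1P[->|/face_sub ->]; rewrite ?eqxx ?orbT.
move=> xT yT xy; split; [exact: sub | exact: sub | done |].
pose Q := \sum_(g <- F | (g != x) && (g != y)) b g.
have Qp : dotv Q p = 0.
  by rewrite dotv_suml big_seq_cond big1 // => g /andP[gF _]; rewrite bfp.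
have QF z : z \in F -> dotv Q z = ((z != x) && (z != y))%:R.
  move=> zF; rewrite dotv_suml big_mkcond (bigD1_seq z) //=.
  rewrite big_seq_cond big1 ?addr0 => [|g /andP[gF gz]].
    by case: ifP => _ //; rewrite bF // eqxx.
  by rewrite bF // (negPf gz) if_same.
have QS z : z \in [seq z <- S | z \notin F] -> 0 < dotv Q z.
  rewrite mem_filter => /andP[zF zS].
  have [g gF gxy] := third x y.
  rewrite dotv_suml big_mkcond (bigD1_seq g) //= gxy ltr_wpDr ?glue_dual_gt0 //.
  rewrite big_seq_cond; apply: sumr_ge0 => f /andP[fF _].
  by case: ifP => // _; apply: glue_dual_ge0.
have [e e0 He] := uniform_eps (fun z => dotv (b p) z) QS.
pose c := if (p == x) || (p == y) then 0 else e.
have c0 : 0 <= c by rewrite /c; case: ifP => // _; apply: ltW.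
have HS z : z \in S -> z \notin F -> 0 < dotv (Q + c *: b p) z.
  move=> zS zF; have zSF : z \in [seq z <- S | z \notin F] by rewrite mem_filter zF.
  rewrite dotvDl dotvZl /c; case: ifP => _; last exact: He.
  by rewrite mul0r addr0 QS.
have HF z : z \in F -> dotv (Q + c *: b p) z = ((z != x) && (z != y))%:R.
  by move=> zF; rewrite dotvDl dotvZl bpf // mulr0 addr0 QF.
have Hp : dotv (Q + c *: b p) p = c by rewrite dotvDl dotvZl bpp Qp mulr1 add0r.
exists (Q + c *: b p) => z; rewrite inE => /predU1P[->|zS].
- by rewrite Hp.
- have [zF|zF] := boolP (z \in F); first by rewrite HF // ler0n.
  exact/ltW/HS.
- by rewrite Hp /c; case: ifP => _; rewrite ?eqxx ?gt_eqF.
have [zF|zF] := boolP (z \in F).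
  by rewrite HF // pnatr_eq0 eqb0 negb_and !negbK.
rewrite gt_eqF ?HS //; apply/esym/negP => zxy.
have : z \in p :: F by case/orP: zxy => /eqP ->.
rewrite inE (negPf zF) orbF => /eqP zp.
by move: zS; rewrite zp (negPf glue_notin).
Qed.

(** An edge inside [F] is an edge of the new simplex. Otherwise an end [z] lies off [F], and
    expanding [h'] at [z] in the coordinates of [p :: F] forces [h'] to be positive at [p], so [h']
    still exposes the edge. *)
Lemma glue_edge_old x y : edge S x y -> edge (p :: S) x y.
Proof.
move=> [xS yS xy [h' h'S h'E]].
have [/andP[xF yF]|nF] := boolP ((x \in F) && (y \in F)).
  by apply: glue_edge_new; rewrite // inE ?xF ?yF orbT.
have [z [zS zF h'z]] : exists z, [/\ z \in S, z \notin F & dotv h' z = 0].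
  move: nF; rewrite negb_and => /orP[zF|zF]; [exists x | exists y];
  by split=> //; apply/eqP; rewrite h'E // eqxx ?orbT.
have h'p : 0 < dotv h' p.
  have [f fF fxy] := third x y; have fS := face_sub fF.
  have h'f : 0 < dotv h' f.
    by rewrite lt_def h'S // andbT h'E // negb_or.
  have : 0 < \sum_(f <- F) dotv (b f) z * dotv h' f.
    rewrite (bigD1_seq f) //= ltr_wpDr ?mulr_gt0 ?glue_dual_gt0 //.
    rewrite big_seq_cond; apply: sumr_ge0 => g /andP[gF _].
    by rewrite mulr_ge0 ?glue_dual_ge0 ?h'S //; apply: face_sub gF.
  move=> sum_gt0; rewrite -(nmulr_rlt0 _ (bp_lt0 zS zF)).
  by have /esym/eqP := evalE h' z; rewrite h'z addr_eq0 => /eqP ->; rewrite oppr_lt0.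
have np v : v \in S -> p == v = false.
  by move=> vS; apply/negP => /eqP pv; have := glue_notin; rewrite pv vS.
split; rewrite ?inE ?xS ?yS ?orbT //.
exists h' => z'; rewrite inE => /predU1P[->|z'S].
- exact: ltW.
- exact: h'S.
- by rewrite gt_eqF // !np.
- exact: h'E.
Qed.

(** The sign of [h] at [y] decides which piece contains it: the old cone, or the glued simplex with
    its facet normals [b f]. *)
Lemma glue_cut_out u : u \in S -> u \notin F -> facets_cut_out (p :: S).
Proof.
move=> uS' uF' y Hy; have [hy|hy] := leP 0 (dotv h y).
  have [h' fh'|w w0 yE] := cutS (y := y).
    case: (beneath fh') => [ff | h'p].
      (* This [h'] is a multiple of [h], and the vertex [u] off [F] shows that the factor is
         nonnegative. *)
      have van z : dotv h' z = dotv (b p) z * dotv h' p.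
        by apply: eval_vanish => g; rewrite -ff => /face_eq0.
      have h'u : 0 <= dotv h' u by case: fh' => _ + _; apply.
      have bu := bp_lt0 uS' uF'.
      have by0 : dotv (b p) y <= 0 by move: hy; rewrite bpE nmulr_lge0.
      by move: h'u; rewrite (van u) (van y) nmulr_rge0 // => h'p; rewrite mulr_le0.
    apply: Hy; case: fh' => h'0 h'S rk'; split=> //.
      by move=> z; rewrite inE => /predU1P[->|]; [apply: ltW | apply: h'S].
    by rewrite /face /= gt_eqF.
  exists (fun z => if z == p then 0 else w z).
    by move=> z; rewrite inE; case: eqP => //= _; apply: w0.
  rewrite big_cons eqxx scale0r add0r {1}yE; apply: eq_big_seq => z zS.
  by case: eqVneq zS => // ->; rewrite (negPf glue_notin).
exists (fun z => if z == p then dotv (b p) y else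
                 if z \in F then dotv (b z) y else 0).
  move=> z; rewrite inE; case: eqP => /= [_ _|_ zS].
    by move: hy; rewrite bpE nmulr_llt0 // => /ltW.
  by case: ifP => // zF; apply/Hy/glue_facet_dual.
have [_ /(_ y) yE] := dual_b; rewrite {1}yE !big_cons eqxx; congr (_ + _).
rewrite big_filter big_mkcond /=; apply: eq_big_seq => z zS.
have -> : z == p = false by apply/negP => /eqP zp; rewrite zp (negPf glue_notin) in zS.
by rewrite mem_face zS andbT; case: ifP => // _; rewrite scale0r.
Qed.

End Glue.

(** A facet of the new cone either misses [p] and is an old one, or contains [p] and omits a single
    vertex [f] of the glued facet, which then serves as its apex. *)
Lemma glue_inv S h p :
  (3 <= k)%N -> stacked_inv S -> facet S h -> dotv h p < 0 ->
  (forall h', facet S h' -> face S h' =i face S h \/ 0 < dotv h' p) ->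
  stacked_inv (p :: S).
Proof.
move=> k3 [uS cutS simS bS] fh hp ben.
have [szF edF [u [uS' uF edu]]] := simS h fh.
have full := glue_full fh hp.
have [b db] : exists b, dual_on (p :: face S h) b.
  by apply: simplex_dual => //=; rewrite szF.
have pS := glue_notin fh hp.
have old := glue_edge_old k3 uS cutS fh szF hp ben db.
have new := glue_edge_new k3 uS cutS fh szF hp ben db.
have uF' : uniq (face S h) by apply: filter_uniq.
have pF : p \notin face S h by apply: contra pS; apply: face_sub.
split; first by rewrite /= pS.
- exact: (glue_cut_out uS cutS fh hp ben db uS' uF).
- move=> h' fh'; have h'p : 0 <= dotv h' p.
    by case: fh' => _ + _; apply; rewrite mem_head.
  have [h'p0|h'p0] := eqVneq (dotv h' p) 0; last first.
    have [|-> fSh'] := glue_facet_old fh'; first by rewrite lt_def h'p0.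
    have [sz' ed' [u' [u'S u'F edu']]] := simS h' fSh'.
    split=> // [x y xF yF xy|]; first exact/old/ed'.
    exists u'; split=> //; first by rewrite inE u'S orbT.
    by move=> x xF; apply/old/edu'.
  have [f fF faceE] := glue_facet_new k3 uS cutS fh szF hp ben db fh' h'p0.
  have inT x : x \in face (p :: S) h' -> x \in p :: face S h.
    by rewrite faceE !inE => /predU1P[->|/mem_rem ->]; rewrite ?eqxx ?orbT.
  have fn : f \notin face (p :: S) h'.
    rewrite faceE inE (mem_rem_uniq _ uF') inE eqxx orbF.
    by apply: contraNneq pF => <-.
  split.
  + have -> : size (face (p :: S) h') = size (p :: rem f (face S h)).
      apply: perm_size; apply: uniq_perm => //.
        by rewrite filter_uniq //= pS.
      rewrite /= rem_uniq // andbT.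
      by apply: contra pF => /mem_rem.
    by rewrite /= size_rem // szF prednK // (leq_trans _ k3).
  + by move=> x y /inT xT /inT yT; apply: new.
  + exists f; split=> //; first by rewrite inE (face_sub fF) orbT.
    move=> x xF; apply: new; rewrite ?inE ?fF ?orbT //; first exact: inT.
    by apply: contraNneq fn => ->.
- apply: (built_step (t := face S h) (u := u)) => //.
  + exact: built_mono bS.
  + exact: face_sub.
  + by move=> x y xF yF xy; apply/old/edF.
  + by move=> x xF; apply/old/edu.
  + move=> x xF; apply: new; rewrite ?inE ?eqxx ?xF ?orbT //.
    by apply: contraNneq pF => ->.
Qed.

Lemma stacked_cone_inv S : (3 <= k)%N -> stacked_cone S -> stacked_inv S.
Proof.
move=> k3; elim=> [{}S szS rkS | {}S h p _ IH fh hp ben]; first exact: simplex_inv.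
exact: glue_inv fh hp ben.
Qed.

End Cones.

(** * Homogenization of polytopes *)

Section Homogenization.
Variables (R : rcfType) (n : nat).
Implicit Types (s : seq 'rV[R]_n) (x y c : 'rV[R]_n) (a : R).

Definition hom x : 'rV[R]_n.+1 := row_mx (1%:M : 'M_1) x.
(** Signed so that the supporting inequality [dotv c x <= a] becomes nonnegativity. *)
Definition afun c a : 'rV[R]_n.+1 := row_mx (a%:M : 'M_1) (- c).

Lemma hom_inj : injective hom.
Proof. by move=> x y E; have [] := @eq_row_mx R 1 1 n _ _ _ _ E. Qed.

Lemma dotv_afun c a x : dotv (afun c a) (hom x) = a - dotv c x.
Proof.
rewrite (@dotv_row_mx _ 1 n) dotvNl; congr (_ - _).
by rewrite dotv_mx tr_scalar_mx mulmx1 mxE eqxx mulr1n.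
Qed.

Lemma afunP (h : 'rV[R]_n.+1) : exists c a, h = afun c a.
Proof.
exists (- rsubmx (h : 'rV_(1 + n))), ((lsubmx (h : 'rV_(1 + n))) 0 0).
by rewrite /afun opprK -mx11_scalar hsubmxK.
Qed.

(** Subtracting the first row from the others leaves differences with homogenizing coordinate 0,
    whose span meets the line of [hom x0] trivially. *)
Lemma rk_hom s : s != [::] -> rk (map hom s) = (affdim s).+1.
Proof.
case: s => [//|x0 r] _.
pose D : 'M_(size r, n) := \matrix_(i < size r) (nth 0 r i - x0).
pose E : 'M_(size r, 1 + n) := row_mx 0 D.
have rowE i : row i E = hom (nth 0 r i) - hom x0.
  rewrite row_row_mx row0 rowK.
  have := @add_row_mx R 1 1 n 1%:M (nth 0 r i) (- 1%:M) (- x0).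
  by rewrite -opp_row_mx subrr => <-.
have -> : affdim (x0 :: r) = \rank E by rewrite rank_row_0mx.
have eqA : (rows_mx (map hom (x0 :: r)) :=: hom x0 + E)%MS.
  apply/eqmxP/andP; split.
    apply: rows_mx_sub => y /mapP[x]; rewrite inE => /predU1P[-> ->|xr ->].
      exact: addsmxSl.
    have ir : (index x r < size r)%N by rewrite index_mem.
    have -> : hom x = hom x0 + row (Ordinal ir) E.
      by rewrite rowE /= nth_index // addrC subrK.
    by apply: addmx_sub; [apply: addsmxSl | apply: submx_trans (row_sub _ _) (addsmxSr _ _)].
  rewrite addsmx_sub; apply/andP; split.
    by apply: mem_rows_mx; rewrite mem_head.
  apply/row_subP => i; rewrite rowE; apply: addmx_sub.
    by apply: mem_rows_mx; apply: map_f; rewrite inE mem_nth ?orbT.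
  by rewrite eqmx_opp; apply: mem_rows_mx; rewrite mem_head.
rewrite /rk eqA mxrank_disjoint_sum.
  have -> : \rank (hom x0) = 1%N; last by rewrite add1n.
  rewrite rank_rV; case: eqP => // h0.
  have : (hom x0 : 'rV_(1 + n)) 0 (lshift n 0) = 0 by rewrite h0 mxE.
  by rewrite row_mxEl mxE eqxx => /eqP; rewrite oner_eq0.
apply/eqP; rewrite -submx0; apply/rV_subP => v; rewrite sub_capmx => /andP[].
move=> /submxP[C vC] /submxP[C' vC'].
have v0 : (v : 'rV_(1 + n)) 0 (lshift n 0) = 0.
  by rewrite vC' /E (@mul_mx_row _ _ _ 1 n) row_mxEl mulmx0 mxE.
move: v0; rewrite vC /hom (@mul_mx_row _ _ _ 1 n) row_mxEl mulmx1 => C0.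
by rewrite [C]mx11_scalar C0 raddf0 mul0mx row_mx0 sub0mx.
Qed.

Lemma face_hom s c a : face (map hom s) (afun c a) = map hom (face_on s c a).
Proof.
rewrite /face filter_map; congr map; apply: eq_filter => x /=.
by rewrite dotv_afun subr_eq0 eq_sym.
Qed.

Lemma nonneg_hom s c a : supports s c a <-> nonneg (map hom s) (afun c a).
Proof.
split=> [/allP sup h /mapP[x xs ->] | nn]; first by rewrite dotv_afun subr_ge0 sup.
by apply/allP => x xs; rewrite -subr_ge0 -dotv_afun nn ?map_f.
Qed.

(** The bound on [n] excludes empty faces: [affdim] of the empty list is 0, which equals [n.-1] when
    [n] is 1. *)
Lemma facet_hom s c a :
  (2 <= n)%N -> is_facet s c a <-> facet (map hom s) (afun c a).
Proof.
move=> n2; split=> [[c0 [sup ad]] | [h0 nn]].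
  split; last 2 first.
  - exact/nonneg_hom.
  - rewrite face_hom rk_hom ?ad ?prednK ?(leq_trans _ n2) //.
    apply/eqP => f0; move: ad n2; rewrite f0 /affdim.
    have := rank_leq_row (\matrix_(i < (@size 'rV[R]_n [::]).-1)
      (nth 0 [::] i.+1 - nth 0 [::] 0 : 'rV[R]_n)).
    by rewrite leqn0 => /eqP ->; case: n => [|[|]].
  apply: contraNneq c0; rewrite /afun -(row_mx0 _ 1 1 n) => E.
  have [_ /eqP] := @eq_row_mx R 1 1 n _ _ _ _ E; by rewrite oppr_eq0.
rewrite face_hom => rkf.
have f0 : face_on s c a != [::].
  apply/eqP => f0; move: rkf; rewrite f0 => rk0.
  by have := rk_size (map hom [::]); rewrite rk0 leqNgt (leq_trans _ n2).
split; last first.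
  split; first exact/nonneg_hom.
  by move: rkf; rewrite rk_hom // => /(congr1 predn).
apply/eqP => c0; move: f0; rewrite -has_filter => /hasP[x _ /=].
rewrite c0 dotv0l => /eqP a0; case/eqP: h0.
by rewrite /afun -a0 c0 oppr0 raddf0 row_mx0.
Qed.

Lemma stacked_hom s : (2 <= n)%N -> stacked s -> stacked_cone (map hom s).
Proof.
move=> n2; elim=> [{}s szs ads | {}s c a p _ IH fc cp ben].
  apply: stacked_cone_simplex; first by rewrite size_map.
  by rewrite rk_hom ?ads //; case: (s) szs.
apply: (stacked_cone_glue (h := afun c a)) => //; first exact/facet_hom.
  by rewrite dotv_afun subr_lt0.
move=> h'; have [c' [a' ->]] := afunP h'; move/(facet_hom _ _ _ n2) => /ben.
rewrite !face_hom dotv_afun subr_gt0 => -[ff|->]; [left | by right].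
by apply: eq_mem_map.
Qed.

Lemma edge_hom s x y : edge (map hom s) (hom x) (hom y) -> poly_edge s x y.
Proof.
rewrite /edge !(mem_map hom_inj) (inj_eq hom_inj) => -[xs ys xy [h nn hE]].
split=> //; have [c [a hca]] := afunP h; exists c, a; rewrite hca in nn hE.
split; first exact/nonneg_hom.
move=> z zs; have := hE (hom z); rewrite map_f // => /(_ isT).
by rewrite dotv_afun subr_eq0 eq_sym !(inj_eq hom_inj).
Qed.

End Homogenization.

Lemma subset_mapP (T T' : eqType) (g : T -> T') (t : seq T') (l : seq T) :
  {subset t <= map g l} -> exists2 t', t = map g t' & {subset t' <= l}.
Proof.
elim: t => [|a t IH] sub; first by exists [::].
have [x xt|t' -> t'l] := IH; first by apply: sub; rewrite inE xt orbT.
have /mapP[a' a'l ->] : a \in map g l by apply: sub; rewrite mem_head.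
by exists (a' :: t') => // x; rewrite inE => /predU1P[->|/t'l].
Qed.

Lemma built_preim (T T' : eqType) (k : nat) (g : T -> T') (E : T -> T -> Prop)
    (E' : T' -> T' -> Prop) (l : seq T) :
  injective g -> (forall x y, E' (g x) (g y) -> E x y) ->
  built k E' (map g l) -> built k E l.
Proof.
move=> gi EE; move Es: (map g l) => s H; elim: H l Es => {s}.
  move=> s szs us Es l sE; subst s; apply: built_base.
  - by rewrite size_map in szs.
  - by rewrite map_inj_uniq in us.
  - by move=> x y xl yl xy; apply/EE/Es; rewrite ?map_f ?inj_eq.
move=> s t u p _ IH ps szt ut ts us unt Et Eu Ep [//|p' l] [pE sE].
subst s p; have [t' tE t'l] := subset_mapP ts; subst t.
have [u' u'l uE] := mapP us; subst u.
rewrite !(mem_map gi) in ps unt; rewrite map_inj_uniq // in ut; rewrite size_map in szt.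
apply: (built_step (t := t') (u := u')) => //; first exact: IH.
- by move=> x y xt yt xy; apply/EE/Et; rewrite ?map_f ?inj_eq.
- by move=> x xt; apply/EE/Eu; rewrite map_f.
- by move=> x xt; apply/EE/Ep; rewrite map_f.
Qed.

Lemma stacked_graph_built (R : rcfType) (d : nat) (V : finType) (e : rel V) :
  (2 <= d)%N -> stacked_polytope_graph R d.+1 e ->
  exists2 l : seq V, built d.+1 e l & forall v, v \in l.
Proof.
move=> d2 [s [f [st fi fs sf ef]]].
have [_ _ _ bt] := stacked_cone_inv (d2 : (3 <= d.+1)%N) (stacked_hom (ltnW d2 : (2 <= d.+1)%N) st).
have [l sE _] : exists2 l, s = map f l & {subset l <= enum V}.
  apply: subset_mapP => x /sf[v <-]; apply: map_f; exact: mem_enum.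
exists l.
  apply: (built_preim (g := @hom R d.+1 \o f) (E' := edge (map (@hom R d.+1) s))).
  - exact: inj_comp (@hom_inj _ _) fi.
  - by move=> u v /edge_hom; rewrite -ef.
  - by rewrite [map _ l]map_comp -sE.
by move=> v; have := fs v; rewrite sE mem_map.
Qed.

(** * Balls and points in Lorentz space *)

Section Lorentz.
Variables (R : rcfType) (d : nat).
Local Notation L := 'rV[R]_(d + 2).
Local Notation E := 'rV[R]_d.
Implicit Types (u v w : L) (x y : E) (a b c : R) (p q : xpoint R d).

Definition lvec x a b : L := row_mx x (\row_(i < 2) (if i == 0 then a else b)).
Definition xpart u : E := lsubmx u.
Definition kpart u : R := u 0 (rshift d 0).
Definition cpart u : R := u 0 (rshift d 1).

Lemma xpart_lvec x a b : xpart (lvec x a b) = x.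
Proof. by rewrite /xpart row_mxKl. Qed.

Lemma kpart_lvec x a b : kpart (lvec x a b) = a.
Proof. by rewrite /kpart row_mxEr mxE. Qed.

Lemma cpart_lvec x a b : cpart (lvec x a b) = b.
Proof. by rewrite /cpart row_mxEr mxE. Qed.

Definition lvecE := (xpart_lvec, kpart_lvec, cpart_lvec).

Lemma lvec_ext u v :
  xpart u = xpart v -> kpart u = kpart v -> cpart u = cpart v -> u = v.
Proof.
move=> ex ek ec; rewrite -[u]hsubmxK -[v]hsubmxK; congr row_mx => //.
apply/rowP => i; rewrite !mxE.
have [->|->] : i = 0 \/ i = 1; [|exact: ek|exact: ec].
by case: i => [[|[|//]]] ?; [left|right]; apply: val_inj.
Qed.

Lemma xpartD u v : xpart (u + v) = xpart u + xpart v. Proof. exact: linearD. Qed.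
Lemma xpartZ a u : xpart (a *: u) = a *: xpart u. Proof. exact: linearZ. Qed.
Lemma xpartN u : xpart (- u) = - xpart u. Proof. exact: linearN. Qed.
Lemma kpartD u v : kpart (u + v) = kpart u + kpart v. Proof. by rewrite /kpart mxE. Qed.
Lemma kpartZ a u : kpart (a *: u) = a * kpart u. Proof. by rewrite /kpart mxE. Qed.
Lemma kpartN u : kpart (- u) = - kpart u. Proof. by rewrite /kpart mxE. Qed.
Lemma cpartD u v : cpart (u + v) = cpart u + cpart v. Proof. by rewrite /cpart mxE. Qed.
Lemma cpartZ a u : cpart (a *: u) = a * cpart u. Proof. by rewrite /cpart mxE. Qed.
Lemma cpartN u : cpart (- u) = - cpart u. Proof. by rewrite /cpart mxE. Qed.

Definition partE :=
  (xpartD, xpartZ, xpartN, kpartD, kpartZ, kpartN, cpartD, cpartZ, cpartN).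

(** Signature (d+1, 1). The quadratic form is |x|^2 - k c, for which balls become unit vectors and
    points null vectors. *)
Definition lform u v : R :=
  dotv (xpart u) (xpart v) - (kpart u * cpart v + cpart u * kpart v) / 2.

Lemma lformC u v : lform u v = lform v u.
Proof. by rewrite /lform dotvC; ring. Qed.

Lemma lformDl u v w : lform (u + v) w = lform u w + lform v w.
Proof. by rewrite /lform !partE dotvDl; field. Qed.

Lemma lformZl a u v : lform (a *: u) v = a * lform u v.
Proof. by rewrite /lform !partE dotvZl; field. Qed.

Lemma lformDr u v w : lform u (v + w) = lform u v + lform u w.
Proof. by rewrite lformC lformDl !(lformC u). Qed.

Lemma lformZr a u v : lform u (a *: v) = a * lform u v.
Proof. by rewrite lformC lformZl lformC. Qed.

Lemma lformNl u v : lform (- u) v = - lform u v.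
Proof. by rewrite -scaleN1r lformZl mulN1r. Qed.

Lemma lformNr u v : lform u (- v) = - lform u v.
Proof. by rewrite lformC lformNl lformC. Qed.

Lemma lform0l v : lform 0 v = 0.
Proof. by rewrite -(scale0r 0) lformZl mul0r. Qed.

Definition lformE := (lformDl, lformDr, lformNl, lformNr, lformZl, lformZr).

Lemma lform_sumr (I : Type) (r : seq I) (P : pred I) (F : I -> L) v :
  lform v (\sum_(i <- r | P i) F i) = \sum_(i <- r | P i) lform v (F i).
Proof.
apply: (big_morph (fun u => lform v u)); first by move=> *; apply: lformDr.
by rewrite lformC lform0l.
Qed.

(* A ball is { p | <ball_vec, point_vec p> >= 0 }: x-part, curvature and
   co-curvature of its bounding sphere, with a sign for the side. *)
Definition ball_vec (B : ball R d) : L :=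
  match B with
  | BIn c r => lvec (r^-1 *: c) r^-1 ((nrm2 c - r ^+ 2) / r)
  | BOut c r => - lvec (r^-1 *: c) r^-1 ((nrm2 c - r ^+ 2) / r)
  | BHalf v a => lvec (- (Num.sqrt (nrm2 v))^-1 *: v) 0 (- (2 * a / Num.sqrt (nrm2 v)))
  end.

Definition point_vec (p : xpoint R d) : L :=
  if p is Some x then lvec x 1 (nrm2 x) else lvec 0 0 1.

Lemma nrm2D x y : nrm2 (x + y) = nrm2 x + 2 * dotv x y + nrm2 y.
Proof. by rewrite /nrm2 !dotvDl !dotvDr (dotvC y x); ring. Qed.

Lemma nrm2N x : nrm2 (- x) = nrm2 x.
Proof. by rewrite /nrm2 dotvNl dotvNr opprK. Qed.

Lemma nrm2Z a x : nrm2 (a *: x) = a ^+ 2 * nrm2 x.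
Proof. by rewrite /nrm2 dotvZl dotvZr; ring. Qed.

Lemma lform_point_vec u p :
  lform u (point_vec p) =
  if p is Some x then dotv (xpart u) x - (kpart u * nrm2 x + cpart u) / 2
  else - (kpart u / 2).
Proof. by case: p => [x|]; rewrite /lform !lvecE ?dotv0r; field. Qed.

Lemma lform_ball_in (c : E) (r : R) x : 0 < r ->
  lform (ball_vec (BIn c r)) (point_vec (Some x)) = (r ^+ 2 - nrm2 (x - c)) / (2 * r).
Proof.
move=> r0; rewrite lform_point_vec /= !lvecE nrm2D nrm2N dotvNr dotvZl (dotvC c).
by field; rewrite gt_eqF.
Qed.

Lemma lform_ball_half (v : E) a x : v != 0 ->
  lform (ball_vec (BHalf v a)) (point_vec (Some x)) =
  (a - dotv v x) / Num.sqrt (nrm2 v).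
Proof.
move=> v0; rewrite lform_point_vec /= !lvecE dotvZl.
by field; rewrite sqrtr_eq0 -ltNge nrm2_gt0.
Qed.

Lemma ball_vec_out (c : E) r : ball_vec (BOut c r) = - ball_vec (BIn c r).
Proof. by []. Qed.

Lemma in_ballE B p : wf_ball B -> in_ball B p = (0 <= lform (ball_vec B) (point_vec p)).
Proof.
case: B => [c r|c r|v a] wf; case: p => [x|].
- by rewrite lform_ball_in // pmulr_lge0 ?subr_ge0 // invr_gt0 mulr_gt0.
- by rewrite lform_point_vec /= !lvecE oppr_ge0 leNgt divr_gt0 ?invr_gt0.
- rewrite ball_vec_out lformNl lform_ball_in // oppr_ge0 pmulr_lle0 ?subr_le0 //.
  by rewrite invr_gt0 mulr_gt0.
- rewrite ball_vec_out lformNl lform_point_vec /= !lvecE opprK.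
  by rewrite divr_ge0 // invr_ge0 ltW.
- by rewrite lform_ball_half // pmulr_lge0 ?subr_ge0 // invr_gt0 sqrtr_gt0 nrm2_gt0.
- by rewrite lform_point_vec /= !lvecE mul0r oppr0 lexx.
Qed.

Lemma in_interiorE B p :
  wf_ball B -> in_interior B p = (0 < lform (ball_vec B) (point_vec p)).
Proof.
case: B => [c r|c r|v a] wf; case: p => [x|].
- by rewrite lform_ball_in // pmulr_lgt0 ?subr_gt0 // invr_gt0 mulr_gt0.
- by rewrite lform_point_vec /= !lvecE oppr_gt0 ltNge divr_ge0 // invr_ge0 ltW.
- rewrite ball_vec_out lformNl lform_ball_in // oppr_gt0 pmulr_llt0 ?subr_lt0 //.
  by rewrite invr_gt0 mulr_gt0.
- rewrite ball_vec_out lformNl lform_point_vec /= !lvecE opprK.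
  by rewrite divr_gt0 // invr_gt0.
- by rewrite lform_ball_half // pmulr_lgt0 ?subr_gt0 // invr_gt0 sqrtr_gt0 nrm2_gt0.
- by rewrite lform_point_vec /= !lvecE mul0r oppr0 ltxx.
Qed.

Lemma ball_vec_unit B : wf_ball B -> lform (ball_vec B) (ball_vec B) = 1.
Proof.
have Lin (c : E) r : 0 < r ->
    lform (lvec (r^-1 *: c) r^-1 ((nrm2 c - r ^+ 2) / r))
          (lvec (r^-1 *: c) r^-1 ((nrm2 c - r ^+ 2) / r)) = 1.
  move=> r0; rewrite /lform !lvecE dotvZl dotvZr -/(nrm2 c).
  by field; rewrite gt_eqF.
case: B => [c r|c r|v a] /= wf; first exact: Lin.
  by rewrite lformNl lformNr opprK Lin.
have s0 : Num.sqrt (nrm2 v) != 0 by rewrite sqrtr_eq0 -ltNge nrm2_gt0.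
rewrite /lform !lvecE dotvZl dotvZr -/(nrm2 v) -{3}(sqr_sqrtr (nrm2_ge0 v)).
by field.
Qed.

Lemma interior_nonempty B : wf_ball B -> exists p, in_interior B p.
Proof.
case: B => [c r|c r|v a] /= wf.
- by exists (Some c); rewrite /= subrr /nrm2 dotv0l exprn_gt0.
- by exists None.
exists (Some (((a - 1) / nrm2 v) *: v)) => /=.
rewrite dotvZr -/(nrm2 v) divfK ?nrm2_eq0 //.
by rewrite gtrBl.
Qed.

Lemma point_vec_inj p q a : point_vec p = a *: point_vec q -> p = q.
Proof.
case: p q => [x|] [y|] //= H.
- have := congr1 kpart H; rewrite !partE !lvecE mulr1 => a1.
  by have := congr1 xpart H; rewrite !partE !lvecE -a1 scale1r => ->.
- by have /eqP := congr1 kpart H; rewrite !partE !lvecE mulr0 oner_eq0.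
- have := congr1 kpart H; rewrite !partE !lvecE mulr1 => a0.
  by have /eqP := congr1 cpart H; rewrite !partE !lvecE -a0 mul0r oner_eq0.
Qed.

(** For finite points the product is minus half the squared distance. *)
Lemma lform_points_lt0 p q : p != q -> lform (point_vec p) (point_vec q) < 0.
Proof.
case: p q => [x|] [y|] // pq; rewrite lform_point_vec /= !lvecE.
- have : 0 < nrm2 (x - y).
    by rewrite nrm2_gt0 subr_eq0; apply: contraNneq pq => ->.
  by rewrite nrm2D nrm2N dotvNr => ?; lra.
- by rewrite oppr_lt0 divr_gt0.
- by rewrite dotv0l mul0r; lra.
Qed.

(* For u orthogonal to the null vector n of p, this represents the class of u in
   the Euclidean space n^perp / n. *)
Definition tangent_part p u : E :=
  if p is Some x then xpart u - kpart u *: x else xpart u.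

Lemma point_orth p u v :
  lform u (point_vec p) = 0 -> lform v (point_vec p) = 0 ->
  dotv (tangent_part p u) (tangent_part p v) = lform u v.
Proof.
case: p => [x|]; rewrite !lform_point_vec /= => hu hv.
  rewrite !(dotvDl, dotvDr, dotvNl, dotvNr, dotvZl, dotvZr) -/(nrm2 x) (dotvC x).
  rewrite /lform.
  have -> : dotv (xpart u) x = (kpart u * nrm2 x + cpart u) / 2 by lra.
  have -> : dotv (xpart v) x = (kpart v * nrm2 x + cpart v) / 2 by lra.
  by field.
have -> : lform u v = dotv (xpart u) (xpart v) - (kpart u * cpart v + cpart u * kpart v) / 2 by [].
have -> : kpart u = 0 by lra.
have -> : kpart v = 0 by lra.
by field.
Qed.

Lemma tangent_part_eq0 p u :
  lform u (point_vec p) = 0 -> tangent_part p u = 0 -> exists a, u = a *: point_vec p.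
Proof.
rewrite lform_point_vec; case: p => [x|] /= hu t0.
  exists (kpart u); have xu : xpart u = kpart u *: x by apply/eqP; rewrite -subr_eq0 t0.
  apply: lvec_ext; rewrite !partE !lvecE ?mulr1 //.
  by move: hu; rewrite xu dotvZl -/(nrm2 x); lra.
exists (cpart u); apply: lvec_ext; rewrite !partE !lvecE ?mulr1 ?scaler0 ?mulr0 //.
by lra.
Qed.

Lemma point_orth_ge0 p u : lform u (point_vec p) = 0 -> 0 <= lform u u.
Proof. by move=> hu; rewrite -(point_orth hu hu) nrm2_ge0. Qed.

Lemma point_orth_eq0 p u :
  lform u (point_vec p) = 0 -> lform u u = 0 -> exists a, u = a *: point_vec p.
Proof.
move=> hu; rewrite -(point_orth hu hu) => /eqP; rewrite [_ == 0]nrm2_eq0 => /eqP.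
exact: tangent_part_eq0.
Qed.

(* [q] is a curve leaving p with velocity x, also when p is the point oo. *)
Lemma nearby_points p x : x != 0 ->
  exists (q : R -> xpoint R d) (g : R) (k : L -> R), 0 < g /\
    forall t, t != 0 -> exists2 l, 0 < l & forall u,
      l * lform u (point_vec (q t)) =
      g * lform u (point_vec p) + dotv (tangent_part p u) x * t + k u * t ^+ 2.
Proof.
move=> x0; case: p => [y|].
  exists (fun t => Some (y + t *: x)), 1, (fun u => - (kpart u * nrm2 x / 2)).
  split=> // t t0; exists 1 => // u; rewrite !lform_point_vec /=.
  by rewrite nrm2D nrm2Z !(dotvDr, dotvDl, dotvNl, dotvZl, dotvZr); field.
exists (fun t => Some (t^-1 *: x)), (nrm2 x), (fun u => - (cpart u / 2)).
split; first by rewrite nrm2_gt0.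
move=> t t0; exists (t ^+ 2); first by rewrite exprn_even_gt0.
by move=> u; rewrite !lform_point_vec /= nrm2Z dotvZr; field.
Qed.

Lemma quad_pos (a b k : R) :
  0 < a \/ a = 0 /\ 0 < b ->
  exists2 e, 0 < e & forall t, 0 < t -> t <= e -> 0 < a + b * t + k * t ^+ 2.
Proof.
have k0 : - `|k| <= k by rewrite lerNl -normrN ler_norm.
have b0 : - `|b| <= b by rewrite lerNl -normrN ler_norm.
have := normr_ge0 k; have := normr_ge0 b => nb nk.
case=> [a0|[-> bp]].
  have m0 : 0 < `|b| + `|k| + 1 by lra.
  exists (Num.min 1 (a / (`|b| + `|k| + 1))); first by rewrite lt_min ltr01 divr_gt0.
  move=> t t0; rewrite le_min ler_pdivlMr // => /andP[t1 ta].
  have t2 : t ^+ 2 <= t by rewrite expr2 ger_pMl.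
  have bt : - `|b| * t <= b * t by rewrite ler_wpM2r // ltW.
  have kt : - `|k| * t ^+ 2 <= k * t ^+ 2 by rewrite ler_wpM2r // sqr_ge0.
  have kt' : `|k| * t ^+ 2 <= `|k| * t by rewrite ler_wpM2l.
  by lra.
have m0 : 0 < `|k| + 1 by lra.
exists (b / (`|k| + 1)); first by rewrite divr_gt0.
move=> t t0; rewrite ler_pdivlMr // => tb.
rewrite add0r expr2 mulrA -mulrDl mulr_gt0 //.
have kt : - `|k| * t <= k * t by rewrite ler_wpM2r // ltW.
by lra.
Qed.

End Lorentz.

(** * Tangency and reflections *)

Section Tangency.
Variables (R : rcfType) (d : nat).
Local Notation L := 'rV[R]_(d + 2).
Implicit Types (u v w : L) (p q : xpoint R d).

(** A small move from [p] in the direction [x] keeps a positive product positive and makes a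
    vanishing one with positive derivative positive, for [u] and [v] at once. *)
Lemma open_point u v p (x : 'rV[R]_d) : x != 0 ->
  0 < lform u (point_vec p) \/
    lform u (point_vec p) = 0 /\ 0 < dotv (tangent_part p u) x ->
  0 < lform v (point_vec p) \/
    lform v (point_vec p) = 0 /\ 0 < dotv (tangent_part p v) x ->
  exists q, 0 < lform u (point_vec q) /\ 0 < lform v (point_vec q).
Proof.
move=> x0 hu hv; have [q [g [k [g0 Hq]]]] := nearby_points p x0.
have pos w : 0 < lform w (point_vec p) \/
      lform w (point_vec p) = 0 /\ 0 < dotv (tangent_part p w) x ->
    0 < g * lform w (point_vec p) \/
      g * lform w (point_vec p) = 0 /\ 0 < dotv (tangent_part p w) x.
  by case=> [w0|[-> ?]]; [left; rewrite mulr_gt0 | right; rewrite mulr0].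
have [e1 e10 H1] := quad_pos (k u) (pos _ hu).
have [e2 e20 H2] := quad_pos (k v) (pos _ hv).
pose t := Num.min e1 e2; have t0 : 0 < t by rewrite lt_min e10.
have [l l0 Hl] := Hq t (lt0r_neq0 t0); exists (q t).
rewrite -(pmulr_rgt0 _ l0) Hl H1 ?ge_min ?lexx //.
by rewrite -(pmulr_rgt0 (lform v _) l0) Hl H2 ?ge_min ?lexx ?orbT.
Qed.

(** The second point is where the normal line at [p] meets the sphere again, or oo for a hyperplane;
    starting from oo it is the foot of the perpendicular from the origin. *)
Lemma boundary_other u p :
  lform u u = 1 -> lform u (point_vec p) = 0 ->
  exists2 q, q != p & lform u (point_vec q) = 0.
Proof.
move=> u1 up; have := point_orth up up; rewrite u1 -/(nrm2 _).
move: up; rewrite lform_point_vec; case: p => [y|] /= up t1.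
  have [k0|k0] := eqVneq (kpart u) 0.
    by exists None => //; rewrite lform_point_vec k0 mul0r oppr0.
  set t := xpart u - _ in t1; exists (Some (y + (2 / kpart u) *: t)).
    apply/eqP => -[] /eqP; rewrite addrC -subr_eq0 addrK scaler_eq0.
    rewrite mulf_eq0 invr_eq0 (negPf k0) pnatr_eq0 /= => /eqP t0.
    by move/eqP: t1; rewrite t0 /nrm2 dotv0l eq_sym oner_eq0.
  rewrite lform_point_vec nrm2D nrm2Z t1.
  have := t1; rewrite {1}/nrm2 {1}/t dotvDl dotvNl dotvZl => xt.
  rewrite dotvDr !dotvZr.
  have -> : dotv (xpart u) t = 1 + kpart u * dotv y t by lra.
  have -> : dotv (xpart u) y = (kpart u * nrm2 y + cpart u) / 2 by lra.
  by field.
exists (Some ((cpart u / 2) *: xpart u)) => //; rewrite lform_point_vec.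
have -> : kpart u = 0 by lra.
by rewrite dotvZr -/(nrm2 _) t1; field.
Qed.

(** The value -1 makes the sum null. The sign of [a] separates balls with disjoint interiors from
    their complements, which have the same product. *)
Definition tangent_vecs u v :=
  lform u v = -1 /\ exists p, exists2 a, 0 < a & u + v = a *: point_vec p.

Lemma tangent_ball_vec B1 B2 :
  wf_ball B1 -> wf_ball B2 -> disjoint_interiors B1 B2 -> tangent B1 B2 ->
  tangent_vecs (ball_vec B1) (ball_vec B2).
Proof.
move=> wf1 wf2 dis [p [[i1 i2] uniq_p]].
set u := ball_vec B1; set v := ball_vec B2.
have dj q : ~ (0 < lform u (point_vec q) /\ 0 < lform v (point_vec q)).
  by rewrite -!in_interiorE //; apply: dis.
have u1 : lform u u = 1 := ball_vec_unit wf1.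
have v1 : lform v v = 1 := ball_vec_unit wf2.
rewrite !in_ballE // in i1 i2; rewrite -/u -/v in i1 i2.
(* [p] lies on both boundaries: were it interior to [w], moving from [p] into [w'] would reach a
   common interior point. *)
have bd w w' : lform w' w' = 1 ->
    (forall q, ~ (0 < lform w (point_vec q) /\ 0 < lform w' (point_vec q))) ->
    0 <= lform w (point_vec p) -> 0 <= lform w' (point_vec p) ->
    lform w (point_vec p) = 0.
  move=> w'1 djw iw iw'; apply/eqP; apply: contraT => nw.
  have wp : 0 < lform w (point_vec p) by rewrite lt_def nw.
  have [w'0|w'0] := eqVneq (lform w' (point_vec p)) 0; last first.
    by case: (djw p); rewrite wp lt_def w'0.
  have tt := point_orth w'0 w'0; rewrite w'1 in tt.
  have x0 : tangent_part p w' != 0 by rewrite -nrm2_eq0 /nrm2 tt oner_eq0.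
  have [||q Hq] := @open_point w w' p _ x0; [by left | | by case: (djw q)].
  by right; rewrite tt.
have up : lform u (point_vec p) = 0 by apply: (bd u v).
have vp : lform v (point_vec p) = 0.
  by apply: (bd v u) => // q [? ?]; apply: (dj q).
have uv_p : lform (u + v) (point_vec p) = 0 by rewrite lformDl up vp addr0.
(* The inward unit normals at [p] are opposite, since otherwise their sum would point into both
   interiors. *)
have x0 : tangent_part p (u + v) = 0.
  apply/eqP; apply: contraT => x0; have := x0; rewrite -nrm2_gt0 /nrm2.
  have := point_orth up uv_p; have := point_orth vp uv_p.
  rewrite (point_orth uv_p uv_p) !lformE u1 v1 (lformC v u) => tv tu pos.
  have [||q Hq] := @open_point u v p _ x0; [right | right | by case: (dj q)].
    by split=> //; rewrite tu; lra.
  by split=> //; rewrite tv; lra.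
have uv : lform u v = -1.
  have := point_orth uv_p uv_p; rewrite x0 dotv0l !lformE u1 v1 (lformC v u); lra.
split=> //; have [a aE] := tangent_part_eq0 uv_p x0.
(* If [a <= 0], another boundary point of [u] would also lie in [v], against the uniqueness of the
   tangency point. *)
exists p, a => //; rewrite ltNge; apply/negP => a0.
have [q qp uq] := boundary_other u1 up.
have : p = q; last by move=> pq; rewrite pq eqxx in qp.
apply: uniq_p; rewrite !in_ballE // -/u -/v uq lexx; split=> //.
have -> : v = a *: point_vec p - u by rewrite -aE [u + v]addrC addrK.
rewrite lformDl lformNl lformZl uq oppr0 addr0 mulr_le0 //.
by apply/ltW/lform_points_lt0; rewrite eq_sym.
Qed.

End Tangency.

(** * Lorentz reflections and the Möbius maps that realize them *)

Section Reflections.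
Variables (R : rcfType) (d : nat).
Local Notation L := 'rV[R]_(d + 2).
Implicit Types (u v w : L) (p q : xpoint R d).

Definition lrefl u v : L := v - (2 * lform u v / lform u u) *: u.

Lemma lrefl_linear u (a : R) v w : lrefl u (a *: v + w) = a *: lrefl u v + lrefl u w.
Proof.
rewrite /lrefl !lformE scalerBr addrACA -opprD scalerA -scalerDl; congr (_ - _ *: _).
by ring.
Qed.

Lemma lrefl_scale u (a : R) v : lrefl u (a *: v) = a *: lrefl u v.
Proof. by rewrite /lrefl lformZr scalerBr scalerA; congr (_ - _ *: _); ring. Qed.

Lemma lrefl_isom u v w : lform u u != 0 -> lform (lrefl u v) (lrefl u w) = lform v w.
Proof. by move=> u0; rewrite !lformE (lformC v u); field. Qed.

Lemma lrefl_inv u v : lform u u != 0 -> lrefl u (lrefl u v) = v.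
Proof.
move=> u0; rewrite /lrefl !lformE.
rewrite -addrA -opprD -scalerDl [X in X *: _](_ : _ = 0) ?scale0r ?subr0 //.
by field.
Qed.

Lemma lrefl_orth u v : lform u v = 0 -> lrefl u v = v.
Proof. by move=> uv; rewrite /lrefl uv mulr0 mul0r scale0r subr0. Qed.

Lemma lrefl_diff u v :
  lform u u = lform v v -> lform (u - v) (u - v) != 0 -> lrefl (u - v) u = v.
Proof.
move=> uv nz; have uvE : 2 * lform (u - v) u = lform (u - v) (u - v).
  by rewrite !lformE (lformC v u) uv; ring.
by rewrite /lrefl uvE divff // scale1r opprB addrC subrK.
Qed.

(** The vector is [k * r] times that of the sphere of inversion. The factor [k] is left free because
    a reflection ignores the scale of its vector. *)
Lemma lrefl_inversion (c : 'rV[R]_d) (r k : R) p : 0 < r -> k != 0 ->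
  exists2 a, 0 < a &
    point_vec (inversion c r p) =
    a *: lrefl (lvec (k *: c) k (k * (nrm2 c - r ^+ 2))) (point_vec p).
Proof.
move=> r0 k0; set u := lvec _ _ _; have rn : r != 0 by rewrite gt_eqF.
have uu : lform u u = k ^+ 2 * r ^+ 2.
  by rewrite /lform !lvecE dotvZl dotvZr -/(nrm2 c); field.
case: p => [x|].
  have ux : lform u (point_vec (Some x)) = k * (r ^+ 2 - nrm2 (x - c)) / 2.
    by rewrite lform_point_vec !lvecE nrm2D nrm2N dotvNr dotvZl (dotvC c); field.
  rewrite /lrefl uu ux /=; have [->|xc] := eqVneq x c.
    rewrite subrr [nrm2 0]dotv0l; exists (r ^+ 2)^-1; first by rewrite invr_gt0 exprn_gt0.
    apply: lvec_ext; rewrite !partE !lvecE.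
    - by apply/rowP => i; rewrite !mxE; field; rewrite ?k0 ?rn.
    - by field; rewrite ?k0 ?rn.
    - by field; rewrite ?k0 ?rn.
  have D0 : nrm2 (x - c) != 0 by rewrite nrm2_eq0 subr_eq0.
  exists (r ^+ 2 / nrm2 (x - c)).
    by rewrite divr_gt0 ?exprn_gt0 // nrm2_gt0 subr_eq0.
  have xE : nrm2 x = nrm2 (x - c) + 2 * dotv c (x - c) + nrm2 c.
    by rewrite -{1}(subrK c x) [LHS]nrm2D (dotvC c).
  apply: lvec_ext; rewrite !partE !lvecE.
  - by apply/rowP => i; rewrite !mxE; field; rewrite ?k0 ?rn ?D0.
  - by field; rewrite ?k0 ?rn ?D0.
  - by rewrite nrm2D nrm2Z dotvZr xE; field; rewrite ?k0 ?rn ?D0.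
have un : lform u (point_vec None) = - (k / 2) by rewrite lform_point_vec !lvecE.
rewrite /lrefl uu un /=; exists (r ^+ 2); first by rewrite exprn_gt0.
apply: lvec_ext; rewrite !partE !lvecE.
- by apply/rowP => i; rewrite !mxE; field; rewrite ?k0 ?rn.
- by field; rewrite ?k0 ?rn.
- by field; rewrite ?k0 ?rn.
Qed.

Lemma lrefl_reflection (v : 'rV[R]_d) (a : R) p : v != 0 ->
  point_vec (reflection v a p) = lrefl (lvec v 0 (2 * a)) (point_vec p).
Proof.
move=> v0; set u := lvec _ _ _.
have uu : lform u u = nrm2 v by rewrite /lform !lvecE -/(nrm2 v); field.
have vn : nrm2 v != 0 by rewrite nrm2_eq0.
case: p => [x|]; last first.
  by rewrite lrefl_orth // lform_point_vec !lvecE mul0r oppr0.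
have ux : lform u (point_vec (Some x)) = dotv v x - a.
  by rewrite lform_point_vec !lvecE; field.
rewrite /lrefl uu ux /=; apply: lvec_ext; rewrite !partE !lvecE.
- by [].
- by field.
- by rewrite nrm2D nrm2N nrm2Z dotvNr dotvZr (dotvC x); field.
Qed.

(** A space-like vector is a multiple of that of a hyperplane or of a sphere, according to whether
    its curvature vanishes. The map [g] is characterized through composition to fit the constructors
    of [mobius]. *)
Lemma lrefl_mobius u : 0 < lform u u ->
  exists g : xpoint R d -> xpoint R d,
    (forall f, mobius f -> mobius (g \o f)) /\
    forall p, exists2 a, 0 < a & point_vec (g p) = a *: lrefl u (point_vec p).
Proof.
move=> uu; have [k0|k0] := eqVneq (kpart u) 0.
  have v0 : xpart u != 0.
    rewrite -nrm2_gt0; move: uu; rewrite /lform k0 -/(nrm2 _).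
    by rewrite mul0r mulr0 addr0 mul0r subr0.
  exists (reflection (xpart u) (cpart u / 2)); split; first by move=> f; apply: mobius_refl.
  move=> p; exists 1 => //; rewrite lrefl_reflection // scale1r; congr lrefl.
  by apply: lvec_ext; rewrite !lvecE //; field.
pose c := (kpart u)^-1 *: xpart u; pose r := Num.sqrt (lform u u / kpart u ^+ 2).
have r2 : r ^+ 2 = lform u u / kpart u ^+ 2.
  by rewrite sqr_sqrtr // divr_ge0 ?sqr_ge0 // ltW.
have r0 : 0 < r by rewrite sqrtr_gt0 divr_gt0 // exprn_even_gt0.
exists (inversion c r); split; first by move=> f; apply: mobius_inv.
move=> p; have [a a0 ->] := lrefl_inversion c p r0 k0; exists a => //.
congr (_ *: lrefl _ _); apply: lvec_ext; rewrite !lvecE //.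
  by rewrite scalerA divff // scale1r.
rewrite r2 nrm2Z /lform -/(nrm2 _); field.
exact: k0.
Qed.

(** Surjectivity is kept because [maps_ball] asks for preimages; the positive factor transports the
    signs that decide membership in balls. *)
Definition realized (phi : L -> L) : Prop :=
  [/\ forall (a : R) v w, phi (a *: v + w) = a *: phi v + phi w,
      forall v w, lform (phi v) (phi w) = lform v w &
      exists f : xpoint R d -> xpoint R d,
        [/\ mobius f, forall q, exists p, f p = q &
            forall p, exists2 a, 0 < a & point_vec (f p) = a *: phi (point_vec p)]].

Lemma realized_id : realized id.
Proof.
split=> //; exists id; split=> [|q|p]; [exact: mobius_id | by exists q |].
by exists 1 => //; rewrite scale1r.
Qed.

Lemma realized_lrefl u phi :
  0 < lform u u -> realized phi -> realized (lrefl u \o phi).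
Proof.
move=> uu [lin iso [f [mf surj fp]]]; have u0 : lform u u != 0 by rewrite gt_eqF.
split=> [a v w|v w|] /=; first by rewrite lin lrefl_linear.
  by rewrite lrefl_isom.
have [g [mg gp]] := lrefl_mobius uu; exists (g \o f); split; first exact: mg.
  move=> q; have [p pE] := surj (g q); exists p; rewrite /= pE.
  have [a a0 aE] := gp (g q); have [b b0 bE] := gp q.
  apply: (@point_vec_inj _ _ _ _ (a * b)).
  by rewrite aE bE lrefl_scale lrefl_inv // scalerA.
move=> p; have [a a0 aE] := fp p; have [b b0 bE] := gp (f p).
by exists (b * a); rewrite ?mulr_gt0 //= bE aE lrefl_scale scalerA.
Qed.

Lemma realizedD phi v w : realized phi -> phi (v + w) = phi v + phi w.
Proof. by case=> lin _ _; rewrite -{1}[v]scale1r lin scale1r. Qed.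

Lemma realizedZ phi (a : R) v : realized phi -> phi (a *: v) = a *: phi v.
Proof.
case=> lin _ _; have phi0 : phi 0 = 0.
  have := lin 1 0 0; rewrite !scale1r addr0 => /eqP.
  by rewrite eq_sym -subr_eq0 addrK => /eqP.
by rewrite -[a *: v]addr0 lin phi0 addr0.
Qed.

Lemma realized_sum phi (T : Type) (r : seq T) (F : T -> L) :
  realized phi -> phi (\sum_(x <- r) F x) = \sum_(x <- r) phi (F x).
Proof.
move=> rp; apply: (big_morph phi); first by move=> v w; apply: realizedD.
by rewrite -[X in phi X](scale0r 0) realizedZ // scale0r.
Qed.

(** One more reflection, in [phi u - v]. The strict inequality makes this vector space-like, and the
    last clause concerns vectors orthogonal to it. *)
Lemma realized_move u v phi :
  realized phi -> lform (phi u) (phi u) = lform v v -> lform (phi u) v < lform v v ->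
  exists2 psi, realized psi & psi u = v /\
    forall w, lform (phi w) (phi u) = lform (phi w) v -> psi w = phi w.
Proof.
move=> rp uv lt_uv; pose w := phi u - v.
have w0 : 0 < lform w w by rewrite /w !lformE uv (lformC v); lra.
exists (lrefl w \o phi); first exact: realized_lrefl.
split=> [|x xE] /=; first by rewrite lrefl_diff // gt_eqF.
by apply: lrefl_orth; rewrite lformC lformDr lformNr xE subrr.
Qed.

Lemma realized_unit u v :
  lform u u = 1 -> lform v v = 1 -> exists2 phi, realized phi & phi u = v.
Proof.
move=> u1 v1; have [lt1|ge1] := ltP (lform u v) 1.
  have [||phi rp [pu _]] := realized_move (u := u) (v := v) realized_id.
  - by rewrite u1.
  - by rewrite v1.
  - by exists phi.
(* Otherwise u reflects to -v, and v reflects -v to v. *)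
have [||phi rp [pu _]] := realized_move (u := u) (v := - v) realized_id.
- by rewrite !lformE u1 v1 opprK.
- by rewrite !lformE v1; lra.
exists (lrefl v \o phi); first by apply: realized_lrefl => //; rewrite v1.
rewrite /= pu /lrefl lformNr v1 -[X in _ - X *: _](_ : -2 = _); last by field.
by rewrite scaleNr opprK scaler_nat mulr2n addrA addNr add0r.
Qed.

(** Once [u1] is matched, the difference for the second pair is orthogonal to [v1], and it is
    space-like exactly when the tangency points differ. If they coincide, [v3] supplies a reflection
    that separates them. *)
Lemma realized_pair u1 u2 v1 v2 v3 :
  lform u1 u1 = 1 -> lform u2 u2 = 1 -> tangent_vecs u1 u2 ->
  lform v1 v1 = 1 -> lform v2 v2 = 1 -> lform v3 v3 = 1 -> tangent_vecs v1 v2 ->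
  lform v1 v3 = -1 -> lform v2 v3 = -1 ->
  exists2 phi, realized phi & phi u1 = v1 /\ phi u2 = v2.
Proof.
move=> u11 u22 [u12 [p [a a0 uE]]] v11 v22 v33 [v12 [p' [a' a'0 vE]]] v13 v23.
have [phi rp pu1] := realized_unit u11 v11.
(* The product assumed negative equals [lform (psi u2) v2 - 1]. *)
have main psi : realized psi -> psi u1 = v1 -> lform (psi (u1 + u2)) (v1 + v2) < 0 ->
    exists2 phi, realized phi & phi u1 = v1 /\ phi u2 = v2.
  move=> rpsi psi1; rewrite realizedD // psi1; have [_ iso _] := rpsi.
  have e12 : lform v1 (psi u2) = -1 by rewrite -psi1 iso.
  rewrite !lformE v11 v12 (lformC (psi u2) v1) e12 => neg.
  have [||chi rchi [c2 fix_chi]] := realized_move (u := u2) (v := v2) rpsi.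
  - by rewrite iso u22.
  - by rewrite v22; lra.
  - by exists chi => //; split=> //; rewrite fix_chi // psi1 e12.
have [_ _ [f [_ _ fp]]] := rp; have [c c0 cE] := fp p.
have nE : phi (u1 + u2) = (a / c) *: point_vec (f p).
  by rewrite uE realizedZ // cE scalerA divfK // gt_eqF.
have ac0 : 0 < a / c by rewrite divr_gt0.
have [pp|pp] := eqVneq (f p) p'; last first.
  apply: (main phi) => //; rewrite nE vE lformZl lformZr.
  by rewrite pmulr_rlt0 // pmulr_rlt0 // lform_points_lt0.
(* Both tangency points agree: first move the point of the u's by a
   reflection fixing v1. *)
pose w := v3 - v2.
have w4 : lform w w = 4 by rewrite !lformE v33 v22 (lformC v3) v23; lra.
have wv1 : lform w v1 = 0 by rewrite !lformE !(lformC _ v1) v13 v12; lra.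
have wv : lform w (v1 + v2) = -2.
  by rewrite lformDr wv1 !lformE v22 (lformC v3) v23; lra.
have pE : phi (u1 + u2) = (a / c / a') *: (v1 + v2).
  by rewrite nE pp vE scalerA divfK // gt_eqF.
have vv : lform (v1 + v2) (v1 + v2) = 0.
  by rewrite !lformE v11 v22 v12 (lformC v2) v12; lra.
have q0 : 0 < a / c / a' by rewrite divr_gt0.
apply: (main (lrefl w \o phi)).
- by apply: realized_lrefl => //; rewrite w4.
- by rewrite /= pu1 lrefl_orth.
rewrite /= pE lrefl_scale lformZl pmulr_rlt0 // /lrefl lformDl lformNl lformZl vv wv w4.
by lra.
Qed.

Lemma realized_clique (T : eqType) (A B : T -> L) (s : seq T) (x1 x2 x3 : T) :
  (forall x, x \in s -> lform (A x) (A x) = 1) ->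
  (forall x, x \in s -> lform (B x) (B x) = 1) ->
  (forall x y, x \in s -> y \in s -> x != y -> tangent_vecs (A x) (A y)) ->
  (forall x y, x \in s -> y \in s -> x != y -> tangent_vecs (B x) (B y)) ->
  uniq [:: x1; x2; x3] -> {subset [:: x1; x2; x3] <= s} ->
  exists2 phi, realized phi & forall x, x \in s -> phi (A x) = B x.
Proof.
move=> A1 B1 tA tB /and3P[]; rewrite !inE negb_or => /andP[x12 x13] x23 _ sub.
have [x1s x2s x3s] : [/\ x1 \in s, x2 \in s & x3 \in s].
  by split; apply: sub; rewrite !inE eqxx ?orbT.
suff H (l : seq T) : {subset l <= s} -> exists2 phi, realized phi &
    [/\ phi (A x1) = B x1, phi (A x2) = B x2 & forall x, x \in l -> phi (A x) = B x].
  by have [|phi rp [_ _ Hp]] := H s _ => //; exists phi.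
elim: l => [|y l IH] ls.
  have [| | | | | | | | |phi rp [p1 p2]] :=
    @realized_pair (A x1) (A x2) (B x1) (B x2) (B x3); rewrite ?A1 ?B1 //.
  - exact: tA.
  - exact: tB.
  - by have [] := tB _ _ x1s x3s x13.
  - by have [] := tB _ _ x2s x3s x23.
  - by exists phi.
have ys : y \in s by apply: ls; rewrite mem_head.
have [x xl|phi rp [p1 p2 pl]] := IH; first by apply: ls; rewrite inE xl orbT.
have [py|py] := eqVneq (phi (A y)) (B y).
  by exists phi => //; split=> // x; rewrite inE => /predU1P[->//|/pl].
have [_ iso _] := rp; set D := phi (A y) - B y.
have fix_x x : x \in s -> phi (A x) = B x ->
    lform (phi (A x)) (phi (A y)) = lform (phi (A x)) (B y).
  move=> xs px; have xy : x != y by apply: contraNneq py => <-; rewrite px.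
  rewrite iso px; have [-> _] := tA _ _ xs ys xy.
  by have [-> _] := tB _ _ xs ys xy.
have Bn x : x \in s -> phi (A x) = B x -> lform (B x) D = 0.
  by move=> xs px; rewrite lformDr lformNr -px fix_x // subrr.
have [v12 [p [a a0 vE]]] := tB _ _ x1s x2s x12.
have Dp : lform D (point_vec p) = 0.
  have : lform D (B x1 + B x2) = 0.
    by rewrite lformDr !(lformC D) !Bn // addr0.
  by rewrite vE lformZr => /eqP; rewrite mulf_eq0 gt_eqF // => /eqP.
have D0 : D != 0 by rewrite subr_eq0.
have AyE : phi (A y) = D + B y by rewrite subrK.
have y1 : x1 != y by apply: contraNneq py => <-; rewrite p1.
have y2 : x2 != y by apply: contraNneq py => <-; rewrite p2.
have yB : lform (B y) (point_vec p) != 0.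
  have : lform (B y) (B x1 + B x2) = -2.
    have [b1 _] := tB _ _ x1s ys y1; have [b2 _] := tB _ _ x2s ys y2.
    by rewrite lformDr !(lformC (B y)) b1 b2; lra.
  by rewrite vE lformZr => H; apply/eqP => H0; move: H; rewrite H0; lra.
have iy : lform (phi (A y)) (phi (A y)) = 1 by rewrite iso A1.
have DE : lform D D = 2 - 2 * lform (phi (A y)) (B y).
  by rewrite !lformE iy B1 // (lformC (B y)); lra.
clearbody D.
(* A null [D] would be a multiple of [point_vec p]. Equality of norms makes it orthogonal to [B y],
   while [point_vec p] is not, so [D] would vanish. *)
have DD : lform D D != 0.
  apply: contraNneq D0 => DD0; have [b bE] := point_orth_eq0 Dp DD0.
  move: iy; rewrite AyE !lformE DD0 (lformC (B y)) B1 // bE lformZl.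
  rewrite (lformC (point_vec p)) => H.
  have : b * lform (B y) (point_vec p) = 0 by lra.
  by move/eqP; rewrite mulf_eq0 (negPf yB) orbF => /eqP ->; rewrite scale0r.
have Dpos : 0 < lform D D by rewrite lt_def DD (point_orth_ge0 Dp).
have [||psi rpsi [psiy fix_psi]] := realized_move (u := A y) (v := B y) rp.
- by rewrite iy B1.
- by rewrite B1 //; lra.
exists psi => //; split.
- by rewrite fix_psi // fix_x.
- by rewrite fix_psi // fix_x.
move=> x; rewrite inE => /predU1P[->//|xl].
have xs : x \in s by apply: ls; rewrite inE xl orbT.
by rewrite fix_psi ?fix_x // pl.
Qed.

(** The Gram matrix is 2I - J, with eigenvalues 2 and -d, so the [b i] form a basis; the form is
    nondegenerate. *)
Lemma descartes_span (b : 'I_(d + 2) -> L) :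
  (0 < d)%N -> (forall i j, lform (b i) (b j) = if i == j then 1 else -1) ->
  forall z, (forall i, lform z (b i) = 0) -> z = 0.
Proof.
move=> d0 bb z zb; pose A : 'M[R]_(d + 2) := \matrix_i b i.
have lfA v w : lform v (w *m A) = \sum_i w 0 i * lform v (b i).
  rewrite mulmx_sum_row lform_sumr; apply: eq_bigr => i _.
  by rewrite rowK lformZr.
have free_A : row_free A.
  apply: inj_row_free => v vA; pose S := \sum_i v 0 i.
  have vS j : 2 * v 0 j = S.
    have := lfA (b j) v; rewrite vA lformC lform0l (bigD1 j) //= bb eqxx mulr1.
    rewrite (eq_bigr (fun i => - v 0 i)); last first.
      by move=> i ij; rewrite bb eq_sym (negPf ij) mulrN1.
    rewrite sumrN => H; rewrite /S (bigD1 j) //=.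
    by move: H; set X := \sum_(_ < _ | _) _; lra.
  have : 2 * S = (d + 2)%:R * S.
    rewrite mulr_sumr (eq_bigr (fun=> S)) => [|i _]; last exact: vS.
    by rewrite sumr_const card_ord mulr_natl.
  rewrite natrD mulrDl => H; have : d%:R * S = 0 by lra.
  move/eqP; rewrite mulf_eq0 pnatr_eq0 -leqn0 leqNgt d0 /= => /eqP S0.
  apply/rowP => j; rewrite mxE; have := vS j; rewrite S0; lra.
have z0 w : lform z w = 0.
  have /submxP[D ->] : (w <= A)%MS by apply: submx_full; rewrite row_full_unit -row_free_unit.
  by rewrite lfA big1 // => i _; rewrite zb mulr0.
have x0 : xpart z = 0.
  have := z0 (lvec (xpart z) 0 0); rewrite /lform !lvecE !mulr0 addr0 mul0r subr0.
  by move/eqP; rewrite [_ == 0]nrm2_eq0 => /eqP.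
have k0 : kpart z = 0.
  by have := z0 (lvec 0 0 1); rewrite /lform !lvecE dotv0r; lra.
have c0 : cpart z = 0.
  by have := z0 (lvec 0 1 0); rewrite /lform !lvecE dotv0r; lra.
by apply: lvec_ext; rewrite ?x0 ?k0 ?c0 /xpart /kpart /cpart ?linear0 ?mxE.
Qed.

(* The two balls tangent to d+1 pairwise tangent balls are exchanged by the
   reflection fixing those d+1 balls. *)
Lemma second_tangent (T : eqType) (b : T -> L) (t : seq T) u w :
  (2 <= d)%N -> uniq t -> size t = d.+1 ->
  (forall x, x \in t -> lform (b x) (b x) = 1) ->
  (forall x y, x \in t -> y \in t -> x != y -> lform (b x) (b y) = -1) ->
  lform u u = 1 -> (forall x, x \in t -> lform u (b x) = -1) ->
  lform w w = 1 -> (forall x, x \in t -> lform w (b x) = -1) ->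
  w = u \/ w = (2 / (d%:R - 1)) *: \sum_(x <- t) b x - u.
Proof.
move=> d2 ut szt b1 bb u1 ub w1 wb; pose m : R := (d%:R - 1)^-1.
have d1 : 0 < d%:R - 1 :> R by rewrite subr_gt0 ltr1n.
have m0 : 0 < m by rewrite invr_gt0.
have dm : (d%:R - 1) * m = 1 by rewrite divff // gt_eqF.
(* The sum has product [1 - d] with each [b x], so [m] brings it to -1, and [u - v] and [w - v]
   become orthogonal to every [b x]. *)
pose v := m *: \sum_(x <- t) b x.
have sum_const (z : L) (a : R) : (forall x, x \in t -> lform z (b x) = a) ->
    lform z v = m * (d%:R + 1) * a.
  move=> za; rewrite lformZr lform_sumr (eq_big_seq (fun=> a)) //.
  by rewrite big_const_seq count_predT szt iter_addr_0 -[a *+ _]mulr_natl -natr1 mulrA.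
have vb x : x \in t -> lform v (b x) = -1.
  move=> xt; rewrite lformC lformZr lform_sumr (bigD1_seq x) //= b1 //.
  rewrite big_seq_cond (eq_bigr (fun=> -1)); last first.
    by move=> y /andP[yt yx]; rewrite bb // eq_sym.
  rewrite -big_seq_cond -big_filter big_const_seq count_predT iter_addr_0.
  have -> : size [seq i <- t | i != x] = d by rewrite -rem_filter // size_rem // szt.
  by rewrite -[-1 *+ d]mulr_natl; lra.
have vv := sum_const _ _ vb; have uv := sum_const _ _ ub; have wv := sum_const _ _ wb.
have N0 : 0 < m * (d%:R + 1) by rewrite mulr_gt0 // ltr_wpDl.
have vE : v = m *: \sum_(x <- t) b x by [].
clearbody v.
move: (m * (d%:R + 1)) N0 vv uv wv => N N0; rewrite !mulrN1 => vv uv wv.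
pose s := lform (w - v) (u - v) / (1 + N).
have N1 : 1 + N != 0 by rewrite gt_eqF //; lra.
have uu : lform (u - v) (u - v) = 1 + N.
  by rewrite !lformE (lformC v u) u1 uv vv; lra.
(* Only a line is orthogonal to all the [b x]: the residual is orthogonal to the Descartes basis
   made of [u] and the [b x]. *)
have zE : w - v = s *: (u - v).
  apply/eqP; rewrite -subr_eq0; apply/eqP; set z := _ - _.
  have zb x : x \in t -> lform z (b x) = 0.
    by move=> xt; rewrite !lformE wb // ub // vb //; lra.
  have zv : lform z v = 0 by rewrite !lformE wv uv vv; lra.
  have zu : lform z u = 0.
    have : lform z (u - v) = 0.
      by rewrite /z lformDl lformNl lformZl uu /s divfK // subrr.
    by rewrite lformDr lformNr zv subr0.
  pose c (i : 'I_(d + 2)) : L := nth 0 (u :: map b t) i.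
  have x0 : T by case: (t) szt.
  have iszt (i : 'I_(d + 2)) k : nat_of_ord i = k.+1 -> (k < size t)%N.
    by move=> ik; rewrite szt -ltnS -ik (leq_trans (ltn_ord i)) // addn2.
  have cS (i : 'I_(d + 2)) k : nat_of_ord i = k.+1 -> c i = b (nth x0 t k).
    by move=> ik; rewrite /c ik /= (nth_map x0) // (iszt i).
  have c0 (i : 'I_(d + 2)) : nat_of_ord i = 0%N -> c i = u by move=> i0; rewrite /c i0.
  apply: (descartes_span (b := c)) => [|i j|i]; first exact: ltnW.
    rewrite -val_eqE /=; case Ei: (nat_of_ord i) => [|k]; case Ej: (nat_of_ord j) => [|l].
    - by rewrite !c0.
    - by rewrite (c0 i) // (cS j l) //= ub // mem_nth // (iszt j).
    - by rewrite (c0 j) // (cS i k) //= lformC ub // mem_nth // (iszt i).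
    have [kt lt] := (iszt _ _ Ei, iszt _ _ Ej).
    rewrite (cS i k) // (cS j l) // eqSS; case: eqVneq => [->|kl].
      by rewrite b1 // mem_nth.
    by rewrite bb ?mem_nth // nth_uniq.
  case Ei: (nat_of_ord i) => [|k]; first by rewrite c0.
  by rewrite (cS i k) // zb // mem_nth // (iszt i).
(* Both differences have norm [1 + N], so the factor is a sign: 1 gives [u], -1 its mirror image. *)
have s2 : s ^+ 2 = 1.
  have : lform (w - v) (w - v) = 1 + N.
    by rewrite !lformE (lformC v w) w1 wv vv; lra.
  rewrite zE lformZl lformZr uu mulrA -expr2 => H.
  by apply: (mulIf N1); rewrite H mul1r.
have wE : w = v + s *: (u - v) by rewrite -zE addrC subrK.
move/eqP: s2; rewrite sqrf_eq1 => /orP[]/eqP sE; [left|right]; rewrite wE sE.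
  by rewrite scale1r addrC subrK.
rewrite scaleN1r opprB addrA -mulr2n vE -scaler_nat scalerA.
by [].
Qed.

End Reflections.

(** * Packings of stacked graphs *)

(** Reversal puts the base clique first. The disequality [w != x] is recorded because [realizes]
    relates edges to tangency only for distinct vertices. *)
Lemma built_rev (T : eqType) (k : nat) (E : T -> T -> Prop) (l : seq T) :
  built k E l ->
  [/\ uniq l, (k < size l)%N,
      forall x y, x \in take k.+1 (rev l) -> y \in take k.+1 (rev l) -> x != y -> E x y &
      forall s1 w s2, rev l = s1 ++ w :: s2 -> (k < size s1)%N ->
        exists t, [/\ size t = k, uniq t, {subset t <= s1},
          forall x y, x \in t -> y \in t -> x != y -> E x y &
          forall x, x \in t -> w != x /\ E w x]].
Proof.
elim=> {l} [s szs us Es | s t u p _ [us szs Es IH] ps szt ut ts _ _ Et _ Ep].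
  split=> //; first by rewrite szs.
    by move=> x y /mem_take + /mem_take; rewrite !mem_rev; apply: Es.
  move=> s1 w s2 /(congr1 size); rewrite size_rev size_cat szs /= => H.
  by rewrite ltnNge -ltnS H addnS ltnS leq_addr.
have pt x : x \in t -> p != x by move=> /ts; apply: contraTneq => <-.
split; [by rewrite /= ps | exact: leqW | |].
  rewrite rev_cons -cats1 take_cat size_rev.
  case: ltnP => [_|le_s]; first exact: Es.
  have /eqP -> : (k.+1 - size s == 0)%N by [].
  by rewrite take0 cats0; move: Es; rewrite take_oversize ?size_rev.
move=> s1 w s2; case/lastP: s2 => [|s2 x].
  rewrite cats1 rev_cons => /rcons_inj[<- <-] _; exists t; split=> //.
    by move=> x /ts; rewrite mem_rev.
  by move=> x xt; split; [apply: pt | apply: Ep].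
by rewrite rev_cons -rcons_cons -rcons_cat => /rcons_inj[/IH + _]; apply.
Qed.

Section Packings.
Variables (R : rcfType) (d : nat) (V : finType) (e : rel V).
Implicit Types (B : V -> ball R d) (l : seq V).

Lemma realizes_vecs B u v :
  realizes e B -> u != v -> e u v -> tangent_vecs (ball_vec (B u)) (ball_vec (B v)).
Proof.
move=> [[wf dis] te] uv euv; apply: tangent_ball_vec => //; first exact: dis.
exact/te.
Qed.

(** This discards the solution [w = u] of [second_tangent]: equal vectors would give equal
    interiors, which are nonempty. *)
Lemma realizes_neq B u v : realizes e B -> u != v -> ball_vec (B u) <> ball_vec (B v).
Proof.
move=> [[wf dis] _] uv E; have [p pu] := interior_nonempty (wf u).
by case: (dis _ _ uv p); split=> //; rewrite in_interiorE // -E -in_interiorE.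
Qed.

Lemma built_apollonian B l :
  realizes e B -> built d.+1 e l -> (forall v, v \in l) -> apollonian B.
Proof.
move=> [[wf dis] te] bl al; have [ul szl cl stepl] := built_rev bl.
exists (rev l); split.
- by rewrite rev_uniq; split=> // v; rewrite mem_rev.
- by rewrite size_rev.
- by move=> v _; apply: wf.
- move=> u v ut vt uv; split; last exact: dis.
  by apply/te => //; apply: cl.
move=> s1 w s2 lE szs; have [t [szt ut ts ct wt]] := stepl s1 w s2 lE szs.
exists t; do 3!split=> //; split=> [u v ut' vt uv|u ut']; apply/te => //.
- exact: ct.
- by have [] := wt u ut'.
- by have [] := wt u ut'.
Qed.

Lemma built_realized B1 B2 l :
  (2 <= d)%N -> realizes e B1 -> realizes e B2 -> built d.+1 e l ->
  exists2 phi, realized phi & forall v, v \in l -> phi (ball_vec (B1 v)) = ball_vec (B2 v).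
Proof.
move=> d2 r1 r2; have [[wf1 _] _] := r1; have [[wf2 _] _] := r2.
elim=> {l} [s szs us Es | s t u p _ [phi rp ps] pns szt ut ts us unt Et Eu Ep].
  have szs3 : (2 < size s)%N by rewrite szs !ltnS ltnW.
  case: s szs3 us Es {szs} => [|x1 [|x2 [|x3 s]]] // _ us Es.
  apply: (realized_clique (x1 := x1) (x2 := x2) (x3 := x3)).
  - by move=> x _; apply: ball_vec_unit.
  - by move=> x _; apply: ball_vec_unit.
  - by move=> x y xs ys xy; apply: realizes_vecs => //; apply: Es.
  - by move=> x y xs ys xy; apply: realizes_vecs => //; apply: Es.
  - by move: us; rewrite -[x1 :: _]/([:: x1; x2; x3] ++ s) cat_uniq => /andP[].
  - by move=> x; rewrite -[x1 :: x2 :: x3 :: s]/([:: x1; x2; x3] ++ s) mem_cat => ->.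
exists phi => // v; rewrite inE => /predU1P[->|]; last exact: ps.
have up x : x \in t -> u != x by move=> xt; apply: contraNneq unt => ->.
have pp x : x \in t -> p != x by move=> /ts xs; apply: contraNneq pns => ->.
have pu : p != u by apply: contraNneq pns => ->.
(* In every realization the new ball is the same linear combination of older ones, so a linear [phi]
   matching those matches it too. *)
have key B : realizes e B -> ball_vec (B p) =
    (2 / (d%:R - 1)) *: \sum_(x <- t) ball_vec (B x) - ball_vec (B u).
  move=> rB; have [[wf _] _] := rB.
  have [||||||/(realizes_neq rB pu)//|//] :=
      @second_tangent R d V (fun x => ball_vec (B x)) t (ball_vec (B u)) (ball_vec (B p)) d2 ut szt.
  - by move=> x _; apply: ball_vec_unit.
  - by move=> x y xt yt xy; have [] := realizes_vecs rB xy (Et _ _ xt yt xy).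
  - exact: ball_vec_unit.
  - by move=> x xt; have [] := realizes_vecs rB (up x xt) (Eu x xt).
  - exact: ball_vec_unit.
  - by move=> x xt; have [] := realizes_vecs rB (pp x xt) (Ep x xt).
rewrite (key B1) // (key B2) // realizedD // realizedZ // realized_sum //.
rewrite -scaleN1r realizedZ // scaleN1r (ps u) //; congr (_ *: _ - _).
by apply: eq_big_seq => x /ts xs; rewrite ps.
Qed.

Lemma realized_maps_ball phi :
  realized phi ->
  exists2 f : xpoint R d -> xpoint R d, mobius f &
    forall A B : ball R d, wf_ball A -> wf_ball B ->
      phi (ball_vec A) = ball_vec B -> maps_ball f A B.
Proof.
move=> [_ iso [f [mf surj fp]]]; exists f => // A B wA wB AB.
have in_f p : in_ball B (f p) = in_ball A p.
  have [a a0 aE] := fp p.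
  by rewrite !in_ballE // -AB aE lformZr iso pmulr_rge0.
move=> q; split=> [qB | [p [pA <-]]]; last by rewrite in_f.
by have [p pq] := surj q; exists p; rewrite -in_f pq.
Qed.

End Packings.

Theorem theorem4p1 (R : rcfType) (d : nat) (V : finType) (e : rel V) :
  (2 <= d)%N ->
  stacked_polytope_graph R d.+1 e ->
  ball_packable R d e ->
  (forall B : V -> ball R d, realizes e B -> apollonian B) /\
  (forall B1 B2 : V -> ball R d, realizes e B1 -> realizes e B2 ->
     mobius_equiv B1 B2).
Proof.
move=> d2 st _; have [l bl al] := stacked_graph_built d2 st.
split=> [B rB | B1 B2 r1 r2]; first exact: built_apollonian bl al.
have [phi rp Hp] := built_realized d2 r1 r2 bl.
have [[wf1 _] _] := r1; have [[wf2 _] _] := r2.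
have [f mf Hf] := realized_maps_ball rp; exists f; split=> //.
have Hv v : maps_ball f (B1 v) (B2 v) by apply: Hf => //; apply: Hp.
by split=> v; exists v.
Qed.
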